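(* Let $G_1$ and $G_2$ be finite simple graphs on disjoint vertex sets $[n_1]$ and $[n_2]$, not both complete. Then $$\mathrm{reg}(J_{G_1*G_2})=\max\{\mathrm{reg}(J_{G_1}),\mathrm{reg}(J_{G_2}),3\}.$$
   Context: For a finite simple graph $G$ on vertex set $V$, the binomial edge ideal $J_G\subseteq K[x_v,y_v: v\in V]$ ($K$ a field) is generated by $x_iy_j-x_jy_i$ for all edges $\{i,j\}$ with $i<j$. $\mathrm{reg}$ denotes Castelnuovo–Mumford regularity, $\mathrm{reg}(M)=\max\{j-i:\beta_{i,j}(M)\neq0\}$; the binomial edge ideal of a graph without edges is the zero ideal, whose regularity is taken to be $0$. The join product $G_1*G_2$ is the graph on $[n_1]\cup[n_2]$ with edge set $E(G_1)\cup E(G_2)\cup\{\{v,w\}:v\in[n_1],w\in[n_2]\}$. *)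

(* Defs.v *)
(* Castelnuovo-Mumford regularity of binomial edge ideals,
   defined from scratch via graded Betti numbers computed by Koszul homology:
   beta_{i,j}(J) = dim_K Tor_i(J,K)_j = dim H_i( /\^i K^V (x) J_{j-i} ). *)
From HB Require Import structures.
From mathcomp Require Import all_boot all_order all_algebra.
Set Implicit Arguments. Unset Strict Implicit. Unset Printing Implicit Defensive.
Import GRing.Theory.
Local Open Scope ring_scope.

Section Koszul.
Variables (K : fieldType) (V : finType) (b : nat).

(* monomials in the variables V with all exponents <= b; every monomial of
   total degree <= b is represented *)
Definition mon := {ffun V -> 'I_b.+1}.
Definition mdeg (m : mon) : nat := (\sum_(v : V) (m v : nat))%N.

Definition poly_space := {ffun mon -> K^o}.

Definition is_mmul2 (u m : mon) (v1 v2 : V) : bool :=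
  [forall v, (u v : nat) == (m v + (v == v1) + (v == v2))%N].

(* a binomial generator ((a,b'),(c,d)) stands for  x_a x_b' - x_c x_d;
   mulgen m g is the polynomial m * g *)
Definition mulgen (m : mon) (g : (V * V) * (V * V)) : poly_space :=
  [ffun u => (is_mmul2 u m g.1.1 g.1.2)%:R - (is_mmul2 u m g.2.1 g.2.2)%:R].

Definition Jdeg (gens : seq ((V * V) * (V * V))) (d : nat) : {vspace poly_space} :=
  <<[seq mulgen m g | m <- [seq m <- enum (predT : pred mon) | (mdeg m + 2 == d)%N],
                      g <- gens]>>%VS.

(* Koszul complex  /\^* K^V (x) S  : coefficient at (basis vector e_A, monomial) *)
Definition kspace := {ffun ({set V} * mon) -> K^o}.

Definition tens (A : {set V}) (f : poly_space) : kspace :=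
  [ffun p => if p.1 == A then f p.2 else 0].

Definition Zsp (gens : seq ((V * V) * (V * V))) (i d : nat) : {vspace kspace} :=
  <<[seq tens A f | A <- [seq A : {set V} <- enum (predT : pred {set V}) | #|A| == i],
                    f <- vbasis (Jdeg gens d)]>>%VS.

(* u / x_k (u k > 0) *)
Definition mshift (u : mon) (k : V) : mon :=
  [ffun v => inord ((u v : nat) - (v == k))%N].

Definition ksign (k : V) (B : {set V}) : K :=
  (-1) ^+ #|[set a in B | (enum_rank a < enum_rank k)%N]|.

(* Koszul differential  e_A (x) f |-> sum_{k in A} +- e_{A\k} (x) x_k f *)
Definition kdiff_fun (phi : kspace) : kspace :=
  [ffun p : {set V} * mon => \sum_(k : V | (k \notin p.1) && (0 < p.2 k)%N)
                ksign k p.1 * phi (k |: p.1, mshift p.2 k)].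

Definition kdiff : 'End(kspace) := linfun kdiff_fun.

End Koszul.

Definition betti (K : fieldType) (V : finType) (gens : seq ((V * V) * (V * V)))
    (i j : nat) : nat :=
  if (i <= j)%N then
    (\dim (lker (kdiff K V j) :&: Zsp K j gens i (j - i))%VS
     - \dim (kdiff K V j @: Zsp K j gens i.+1 (j - i).-1)%VS)%N
  else 0%N.

(* reg(J) = r : r = max { j - i : beta_{i,j}(J) <> 0 }, and r = 0 for J = 0 *)
Definition is_reg (K : fieldType) (V : finType) (gens : seq ((V * V) * (V * V)))
    (r : nat) : Prop :=
  (forall i j, betti K gens i j <> 0%N -> (j <= i + r)%N) /\
  ((exists i j, betti K gens i j <> 0%N /\ j = (i + r)%N) \/
   (r = 0%N /\ forall i j, betti K gens i j = 0%N)).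

Definition simple_graph (n : nat) (e : rel 'I_n) : Prop :=
  symmetric e /\ irreflexive e.

Definition complete_graph (n : nat) (e : rel 'I_n) : Prop :=
  forall u v : 'I_n, u != v -> e u v.

(* variables x_v = (v,false), y_v = (v,true);
   generators x_i y_j - x_j y_i for edges {i,j}, i < j *)
Definition bei_gens (n : nat) (e : rel 'I_n) : seq ((('I_n * bool) * ('I_n * bool)) * (('I_n * bool) * ('I_n * bool))) :=
  [seq (((p.1, false), (p.2, true)), ((p.2, false), (p.1, true)))
  | p <- [seq p <- [seq (a, c) | a <- enum 'I_n, c <- enum 'I_n]
         | e p.1 p.2 && (val p.1 < val p.2)%N]].

Definition join_graph (n1 n2 : nat) (e1 : rel 'I_n1) (e2 : rel 'I_n2) : rel 'I_(n1 + n2) :=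
  fun u v => match split u, split v with
             | inl a, inl c => e1 a c
             | inr a, inr c => e2 a c
             | _, _ => true
             end.

(* Main.v *)
(** Grade the polynomial ring of [G1 * G2] by the degrees in the variables of [G1] and
    of [G2]. In mixed bidegrees the binomial edge ideal of the join agrees with that of
    the complete graph, because [z_k f_ij] is a combination of [f_kj] and [f_ik]; in pure
    bidegrees it is the ideal of [G1] or of [G2]. The complete graph has a linear
    resolution, so a Koszul cycle of the join in degree [i + r], [r >= 4], bounds over the
    ideal of the complete graph, and the bound can be corrected, one pure component at a
    time, when the ideals of [G1] and [G2] have no homology in the degrees [i' + r].
    Conversely, the Koszul homology of an induced subgraph embeds. Finally, a join of
    graphs that are not both complete contains an induced path on three vertices, whose
    ideal is a complete intersection of two quadrics of regularity 3.

    The linear resolution of the complete graph is obtained over the Segre ring, generated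
    by the [s t_i] and [s' t_i]: in a fixed multidegree its Koszul complex consists of the simplicial chains
    on the sets of variables with at most [P] elements of each kind [x], [y] and at most
    [c_v] elements over each vertex [v], a truncated double complex with exact rows and
    columns. *)
Require Import Defs.
From HB Require Import structures.
From mathcomp Require Import all_boot all_order all_algebra.
From mathcomp Require Import ring zify.
Set Implicit Arguments. Unset Strict Implicit. Unset Printing Implicit Defensive.
Import GRing.Theory.

(** * Exterior algebra operations on set chains *)

(** Everything is reduced to [exactK], exactness of one strand of the Koszul complex, so that bounds
    of cycles can be corrected explicitly. The obstacle is that the exterior part of a chain of the
    join mixes the two factors even where its coefficients are pure. For each set [B] of variables
    outside [G1], the coefficients on the sets that meet the outside in [B], at monomials in the
    variables of [G1], form a Koszul chain over [G1] whose exterior degree is lowered by [#|B|].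
    Hence there is one correction for each [B], and vanishing for [G1] is required in all
    homological degrees. The bound 4 arises because a correction comes from the linear resolution
    one degree lower, which needs [3 <= d - 1]. Its coefficients then have degree [d - 2 > 0], and a
    monomial of positive degree cannot be pure for both factors, so the corrections for [G1] and
    [G2] do not interfere. *)

Section SetChains.
Local Open Scope ring_scope.
Variables (K : fieldType) (V : finType).
Implicit Types (A B : {set V}) (k l : V) (f g : {ffun {set V} -> K}).

(** The Koszul differential of a strand in which the set determines the monomial: the simplicial
    boundary, written on coefficient functions, with the signs of [kdiff]. *)
Definition boundary f : {ffun {set V} -> K} :=
  [ffun A : {set V} => \sum_(k | k \notin A) ksign K k A * f (k |: A)].

Definition contract k f : {ffun {set V} -> K} :=
  [ffun A : {set V} => if k \in A then 0 else ksign K k A * f (k |: A)].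

Definition wedge k f : {ffun {set V} -> K} :=
  [ffun A : {set V} => if k \in A then ksign K k (A :\ k) * f (A :\ k) else 0].

Lemma ksignU k l A : l \notin A ->
  ksign K k (l |: A) = (-1) ^+ (enum_rank l < enum_rank k)%N * ksign K k A.
Proof.
move=> lA; rewrite /ksign -exprD; congr (_ ^+ _).
case: ltnP => h.
  rewrite (_ : [set a in l |: A | _] =
    l |: [set a in A | (enum_rank a < enum_rank k)%N]); last first.
    by apply/setP => a; rewrite !inE; case: eqP => [->|]; rewrite ?h ?orbT.
  by rewrite cardsU1 inE (negbTE lA).
rewrite add0n; apply: eq_card => a; rewrite !inE.
by case: eqP => [->|] //=; rewrite (negbTE lA) ltnNge h.
Qed.

Lemma ksignK k A x : ksign K k A * (ksign K k A * x) = x.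
Proof. by rewrite mulrA -expr2 sqrr_sign mul1r. Qed.

Lemma boundaryE f : boundary f = \sum_k contract k f.
Proof.
apply/ffunP => A; rewrite ffunE sum_ffunE big_mkcond /=.
by apply: eq_bigr => k _; rewrite ffunE; case: (k \in A).
Qed.

Lemma contract_wedge_id k f : contract k (wedge k f) + wedge k (contract k f) = f.
Proof.
apply/ffunP => A; rewrite !ffunE; case: ifP => kA.
  by rewrite !inE eqxx /= setD1K // ksignK add0r.
by rewrite !inE eqxx /= setU1K ?kA // ksignK addr0.
Qed.

Lemma sign_swap k l : k != l ->
  (-1) ^+ (enum_rank l < enum_rank k)%N = - (-1) ^+ (enum_rank k < enum_rank l)%N :> K.
Proof.
move=> kl; have : enum_rank k != enum_rank l by rewrite (inj_eq enum_rank_inj).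
rewrite -val_eqE /= neq_ltn; case: ltngtP => //= _ _.
  by rewrite expr0 expr1 opprK.
Qed.

Lemma contractC k l f : contract k (contract l f) = - contract l (contract k f).
Proof.
apply/ffunP => A; rewrite !ffunE !inE.
case: (eqVneq k l) => [->|kl]; first by case: ifP; rewrite /= ?mulr0 oppr0.
rewrite /=.
case: (boolP (k \in A)) => kA; case: (boolP (l \in A)) => lA;
  rewrite ?mulr0 ?oppr0 //.
rewrite !ksignU // (sign_swap kl) setUCA; move: ((-1) ^+ _) (ksign _ _ _) (ksign _ _ _) => e x y;
  ring.
Qed.

Lemma contract_contract k f : contract k (contract k f) = 0.
Proof.
by apply/ffunP => A; rewrite !ffunE !inE eqxx /=; case: ifP; rewrite ?mulr0.
Qed.

Lemma contract_wedge k l f : k != l -> contract k (wedge l f) = - wedge l (contract k f).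
Proof.
move=> kl; apply/ffunP => A; rewrite !ffunE !inE (negbTE kl) (eq_sym l k) (negbTE kl) /=.
case: (boolP (k \in A)) => kA; case: (boolP (l \in A)) => lA;
  rewrite ?mulr0 ?oppr0 //.
have -> : (k |: A) :\ l = k |: (A :\ l).
  by apply/setP => a; rewrite !inE; case: (eqVneq a k) => // ->; rewrite kl.
rewrite -{1}(setD1K lA) !ksignU ?inE ?eqxx ?(negbTE kA) ?andbF //.
rewrite (sign_swap kl); move: (sqrr_sign K (enum_rank k < enum_rank l)%N).
move: ((-1) ^+ _) (ksign _ _ _) (ksign _ _ _) (f _) => e x y z e2.
by rewrite -[RHS]mul1r -e2; ring.
Qed.

Lemma wedgeD k f g : wedge k (f + g) = wedge k f + wedge k g.
Proof. by apply/ffunP => A; rewrite !ffunE; case: ifP; rewrite ?addr0 ?mulrDr. Qed.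
Lemma wedge0 k : wedge k 0 = 0.
Proof. by apply/ffunP => A; rewrite !ffunE mulr0 if_same. Qed.
Lemma wedge_sum k (T : finType) (P : pred T) (F : T -> {ffun {set V} -> K}) :
  wedge k (\sum_(t | P t) F t) = \sum_(t | P t) wedge k (F t).
Proof. by apply: (big_morph (wedge k) (wedgeD k) (wedge0 k)). Qed.

Lemma contractD k f g : contract k (f + g) = contract k f + contract k g.
Proof. by apply/ffunP => A; rewrite !ffunE; case: ifP; rewrite ?addr0 ?mulrDr. Qed.
Lemma contract0 k : contract k 0 = 0.
Proof. by apply/ffunP => A; rewrite !ffunE mulr0 if_same. Qed.
Lemma contract_sum k (T : finType) (P : pred T) (F : T -> {ffun {set V} -> K}) :
  contract k (\sum_(t | P t) F t) = \sum_(t | P t) contract k (F t).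
Proof. by apply: (big_morph (contract k) (contractD k) (contract0 k)). Qed.

Lemma boundaryD f g : boundary (f + g) = boundary f + boundary g.
Proof.
by apply/ffunP => A; rewrite !ffunE -big_split; apply: eq_bigr => k _; rewrite ffunE mulrDr.
Qed.
Lemma boundaryN f : boundary (- f) = - boundary f.
Proof.
by apply/ffunP => A; rewrite !ffunE -sumrN; apply: eq_bigr => k _; rewrite ffunE mulrN.
Qed.
Lemma boundaryB f g : boundary (f - g) = boundary f - boundary g.
Proof. by rewrite boundaryD boundaryN. Qed.
Lemma boundary0 : boundary 0 = 0.
Proof. by apply/ffunP => A; rewrite !ffunE big1 // => k _; rewrite ffunE mulr0. Qed.

Definition boundary_on (p : pred V) f := \sum_(k | p k) contract k f.

(** Wedging with [k] contracts any partial boundary that contains the direction [k], because the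
    other directions anticommute with it. *)
Lemma boundary_on_wedge (p : pred V) k f : p k ->
  boundary_on p (wedge k f) = f - wedge k (boundary_on p f).
Proof.
move=> pk; rewrite /boundary_on wedge_sum (bigD1 k) //= [in RHS](bigD1 k) //=.
rewrite (eq_bigr (fun l => - wedge k (contract l f))); last by move=> l /andP[_];
  exact: contract_wedge.
by rewrite sumrN opprD addrA; congr (_ - _); rewrite -{2}(contract_wedge_id k f) addrK.
Qed.

Lemma boundary_wedge k f : boundary (wedge k f) = f - wedge k (boundary f).
Proof. by rewrite !boundaryE; apply: (@boundary_on_wedge xpredT). Qed.

(* Pairing [k < l] with [l < k] keeps the argument valid in characteristic 2. *)
Lemma sum_antisym (F : V -> V -> {ffun {set V} -> K}) :
  (forall k, F k k = 0) -> (forall k l, F k l = - F l k) ->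
  \sum_k \sum_l F k l = 0.
Proof.
move=> F0 Fa.
pose r (k l : V) := (enum_rank k < enum_rank l)%N.
have E k : \sum_l F k l = \sum_(l | r k l) F k l + \sum_(l | r l k) F k l.
  rewrite (bigID (r k)) /=; congr (_ + _).
  rewrite [LHS]big_mkcond [RHS]big_mkcond /=; apply: eq_bigr => l _.
  rewrite /r; case: ltngtP => //= e.
  by rewrite (_ : k = l) //; apply: enum_rank_inj; apply: val_inj.
under eq_bigr => k _ do rewrite E.
rewrite big_split /= [X in _ + X](exchange_big_dep xpredT) //= -big_split /=.
apply: big1 => k _; rewrite -big_split /=; apply: big1 => l _.
by rewrite (Fa l k) subrr.
Qed.

Lemma boundary_boundary f : boundary (boundary f) = 0.
Proof.
rewrite !boundaryE; under eq_bigr => k _ do rewrite contract_sum.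
by apply: sum_antisym => [k|k l]; [apply: contract_contract | apply: contractC].
Qed.

Lemma boundary_supp f A : boundary f A != 0 -> exists2 k, k \notin A & f (k |: A) != 0.
Proof.
rewrite ffunE => nz.
case: (pickP [pred k | (k \notin A) && (f (k |: A) != 0)]) => [k /andP[]|no].
  by exists k.
move/eqP: nz; case; apply: big1 => k kA; move: (no k).
by rewrite /= kA /= => /negbFE /eqP ->; rewrite mulr0.
Qed.

Lemma wedge_supp k f A : wedge k f A != 0 -> k \in A /\ f (A :\ k) != 0.
Proof.
by rewrite ffunE; case: ifP => // _; rewrite ?eqxx // mulf_eq0 negb_or => /andP[].
Qed.

Lemma contract_supp k f A : contract k f A != 0 -> k \notin A /\ f (k |: A) != 0.
Proof.
by rewrite ffunE; case: ifP => // _; rewrite ?eqxx // mulf_eq0 negb_or => /andP[].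
Qed.

End SetChains.

(** * Exactness of the multigraded strands of the Segre ring *)

Section SegreChains.
Local Open Scope ring_scope.
Variables (K : fieldType) (I : finType).
Notation V := (I * bool)%type.
Implicit Types (A : {set V}) (k : V) (f g : {ffun {set V} -> K}).
Implicit Types (c : I -> nat) (P : bool -> nat).

Definition side_deg (t : bool) A := #|[set a in A | a.2 == t]|.
Definition vertex_deg (v : I) A := #|[set a in A | a.1 == v]|.

Lemma card_selU1 (T : finType) (p : pred T) (k : T) (A : {set T}) : k \notin A ->
  #|[set a in k |: A | p a]| = (p k + #|[set a in A | p a]|)%N.
Proof.
move=> kA; case: (boolP (p k)) => pk.
  rewrite (_ : [set a in _ | _] = k |: [set a in A | p a]); last first.
    by apply/setP => a; rewrite !inE; case: eqP => [->|]; rewrite ?pk.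
  by rewrite cardsU1 inE (negbTE kA).
by apply: eq_card => a; rewrite !inE; case: eqP => [->|] //=; rewrite (negbTE pk) andbF.
Qed.

Lemma side_degU t k A : k \notin A -> side_deg t (k |: A) = ((k.2 == t) + side_deg t A)%N.
Proof. exact: card_selU1. Qed.

Lemma vertex_degU v k A : k \notin A -> vertex_deg v (k |: A) = ((k.1 == v) + vertex_deg v A)%N.
Proof. exact: card_selU1. Qed.

Lemma card_side_deg A : #|A| = (side_deg false A + side_deg true A)%N.
Proof.
rewrite -(cardsID [set a | a.2] A) addnC /side_deg.
have -> : A :&: [set a | a.2] = [set a in A | a.2 == true].
  by apply/setP => a; rewrite !inE eqb_id.
have -> // : A :\: [set a | a.2] = [set a in A | a.2 == false].
by apply/setP => a; rewrite !inE eqbF_neg andbC.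
Qed.

Lemma card_side_degN t A : #|A| = (side_deg t A + side_deg (~~ t) A)%N.
Proof. by rewrite card_side_deg; case: t => //; rewrite addnC. Qed.

Lemma sum_vertex_deg A : (\sum_v vertex_deg v A = #|A|)%N.
Proof.
rewrite -sum1_card (partition_big (fun a : V => a.1) xpredT) //=.
by apply: eq_bigr => v _; rewrite sum1dep_card /vertex_deg; congr #|pred_of_set _|; apply/setP => a;
  rewrite !inE.
Qed.

(** The limits on the two sides are dropped, which is what makes whole rows exact; [segre_exact]
    restores them. *)
Definition vertex_chain c m f := forall A, f A != 0 ->
  #|A| = m /\ forall v, (vertex_deg v A <= c v)%N.

Lemma vertex_chain_add c m f g : vertex_chain c m f -> vertex_chain c m g ->
  vertex_chain c m (f + g).
Proof.
move=> hf hg A; rewrite ffunE; case: (eqVneq (f A) 0) => [->|/hf //].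
by rewrite add0r => /hg.
Qed.

Lemma vertex_chain_opp c m f : vertex_chain c m f -> vertex_chain c m (- f).
Proof. by move=> hf A; rewrite ffunE oppr_eq0 => /hf. Qed.

Lemma vertex_chain_boundary c m f : vertex_chain c m.+1 f -> vertex_chain c m (boundary f).
Proof.
move=> hf A /boundary_supp [k kA /hf [hm h1]]; split.
  by move: hm; rewrite cardsU1 kA => -[].
by move=> v; apply: leq_trans (h1 v); rewrite vertex_degU // leq_addl.
Qed.

Section Row.
Variable t : bool.

Definition side : pred V := fun k => k.2 == t.
Definition opp_part A : {set V} := [set a in A | a.2 != t].
Definition row_part (B : {set V}) f : {ffun {set V} -> K} :=
  [ffun A : {set V} => if opp_part A == B then f A else 0].

Lemma row_part_sum f : f = \sum_B row_part B f.
Proof.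
apply/ffunP => A; rewrite sum_ffunE (bigD1 (opp_part A)) //= ffunE eqxx big1 ?addr0 //.
by move=> B /negbTE h; rewrite ffunE eq_sym h.
Qed.

Lemma opp_partU k A : k.2 = t -> opp_part (k |: A) = opp_part A.
Proof.
move=> kt; apply/setP => a; rewrite !inE; case: (eqVneq a k) => [->|//].
by rewrite kt eqxx !andbF.
Qed.

Lemma boundary_on_row_part B f : boundary_on side (row_part B f) = row_part B (boundary_on side f).
Proof.
apply/ffunP => A; rewrite /boundary_on sum_ffunE ffunE sum_ffunE; case: ifP => h.
  by apply: eq_bigr => k /eqP kt; rewrite !ffunE opp_partU // h.
by apply: big1 => k /eqP kt; rewrite !ffunE opp_partU // h mulr0 if_same.
Qed.

Lemma boundary_split f : boundary f = boundary_on side f + boundary_on (predC side) f.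
Proof. by rewrite boundaryE /boundary_on (bigID side). Qed.

Lemma boundary_on_supp (p : pred V) f A : boundary_on p f A != 0 ->
  exists k, [/\ p k, k \notin A & f (k |: A) != 0].
Proof.
rewrite /boundary_on sum_ffunE => nz.
case: (pickP [pred k | p k && (contract k f A != 0)]) => [k /andP[pk /contract_supp []]|no].
  by exists k.
move/eqP: nz; case; apply: big1 => k pk; move: (no k).
by rewrite /= pk /= => /negbFE /eqP.
Qed.

Lemma boundary_on_local (p : pred V) f g A :
  (forall k, p k -> k \notin A -> f (k |: A) = g (k |: A)) ->
  boundary_on p f A = boundary_on p g A.
Proof.
move=> h; rewrite /boundary_on !sum_ffunE; apply: eq_bigr => k pk; rewrite !ffunE.
by case: ifP => // /negbT kA; rewrite h.
Qed.

(* With the part of [A] on the other side fixed, the sets [A] form a full simplex; it is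
   contracted to a vertex depending on that part. *)
Lemma row_exact c m f : vertex_chain c m f -> (m < \sum_v c v)%N -> boundary_on side f = 0 ->
  exists2 w, vertex_chain c m.+1 w & boundary_on side w = f /\
    (forall A, w A != 0 -> exists k, [/\ k \in A, k.2 = t & f (A :\ k) != 0]).
Proof.
move=> hf hm bf.
(* The default 0 is correct: if no vertex has room over [B], then [B] has at least [\sum_v c v > m]
   elements, and [row_part B f] vanishes. *)
pose W B := if [pick v | (vertex_deg v B < c v)%N] is Some v then wedge (v, t) (row_part B f) else 0.
have nzW A : (\sum_B W B) A != 0 -> exists k, [/\ k \in A, k.2 = t, f (A :\ k) != 0
    & (vertex_deg k.1 (opp_part (A :\ k)) < c k.1)%N].
  rewrite sum_ffunE => nz.
  case: (pickP [pred B | W B A != 0]) => [B /=|no]; last first.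
    by move/eqP: nz; case; apply: big1 => B _; move: (no B) => /= /negbFE /eqP.
  rewrite /W; case: pickP => [v hv|_]; last by rewrite ffunE eqxx.
  move=> /wedge_supp [kA]; rewrite ffunE; case: ifP => [/eqP E|_]; last by rewrite eqxx.
  by move=> nf; exists (v, t); split=> //; rewrite E.
exists (\sum_B W B); last split.
- move=> A /nzW [k [kA kt nf hv]]; have [h1 h2] := hf _ nf.
  have kA' : k \notin A :\ k by rewrite !inE eqxx.
  split; first by rewrite (cardsD1 k) kA h1.
  move=> v; rewrite -(setD1K kA) vertex_degU //; case: eqP => [<-|_]; last exact: h2.
  (* Over [k.1] the set [A :\ k] has no element on side [t], so its count there is that of its
     opposite part. *)
  rewrite add1n; apply: leq_trans hv; rewrite ltnS subset_leq_card //; apply/subsetP => a.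
  rewrite !inE => /andP[/andP[ak ->] /eqP a1]; rewrite ak a1 eqxx andbT /=.
  by apply: contraNneq ak => a2; rewrite [a]surjective_pairing [k]surjective_pairing a1 a2 kt.
- rewrite [RHS]row_part_sum /boundary_on; under eq_bigr => k _ do rewrite contract_sum.
  rewrite exchange_big /=; apply: eq_bigr => B _; rewrite -/(boundary_on side (W B)) /W.
  case: pickP => [v hv|no].
    rewrite boundary_on_wedge ?/side ?eqxx // -/side boundary_on_row_part bf.
    rewrite (_ : row_part B 0 = 0) ?wedge0 ?subr0 //.
    by apply/ffunP => A; rewrite !ffunE if_same.
  apply/ffunP => A; rewrite /boundary_on sum_ffunE big1; last by move=> k _;
    rewrite contract0 ffunE.
  rewrite ffunE; case: ifP => // /eqP E; case: (eqVneq (f A) 0) => [-> //|/hf [hA _]].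
  have : (#|B| <= #|A|)%N by rewrite -E subset_leq_card //; apply/subsetP => a;
    rewrite inE => /andP[].
  rewrite hA -sum_vertex_deg leqNgt; case/negP; apply: leq_trans hm _.
  by apply: leq_sum => v _; move: (no v) => /=; lia.
- by move=> A /nzW [k [kA kt nf _]]; exists k.
Qed.

End Row.

Lemma sideN t k : predC (side t) k -> k.2 = ~~ t.
Proof. by rewrite /side /=; case: k.2; case: t. Qed.

Lemma side_deg_add t k A : k.2 = t -> k \notin A -> side_deg t (k |: A) = (side_deg t A).+1.
Proof. by move=> <- kA; rewrite side_degU // eqxx. Qed.

Lemma side_deg_addN t k A : k.2 = ~~ t -> k \notin A -> side_deg t (k |: A) = side_deg t A.
Proof. by move=> kt kA; rewrite side_degU // kt; case: (t). Qed.

(* Exactness of the total complex of a double complex with exact rows, in the half plane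
   where the degree on the side [~~ t] is at least [q]. *)
Lemma half_plane_exact (t : bool) c (m q Q N : nat) : forall f,
  vertex_chain c m f -> (m < \sum_v c v)%N ->
  (forall A, f A != 0 -> (q <= side_deg (~~ t) A <= Q)%N /\ (m < side_deg t A + N)%N) ->
  (forall A, (q <= side_deg (~~ t) A)%N -> boundary f A = 0) ->
  exists2 w, vertex_chain c m.+1 w &
    (forall A, w A != 0 -> (q <= side_deg (~~ t) A <= Q)%N) /\
    (forall A, (q <= side_deg (~~ t) A)%N -> boundary w A = f A).
Proof.
elim: N => [|N IH] f hf hm hs bf.
  have f0 : f = 0.
    apply/ffunP => A; rewrite [RHS]ffunE; apply/eqP; case: eqVneq => // nz.
    have [_] := hs _ nz; have [h _] := hf _ nz; move: h; rewrite (card_side_degN t); lia.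
  exists 0; first by move=> A; rewrite ffunE eqxx.
  by split=> [A|A _]; rewrite ?boundary0 ?f0 ffunE ?eqxx.
(* The piece of least degree on side [t]. Nothing else contributes one degree lower, so it is a row
   cycle, and subtracting the boundary of its row bound raises the least degree by one. *)
pose f0 : {ffun {set V} -> K} := [ffun A : {set V} => if (side_deg t A + N == m)%N then f A else 0].
have f0s A : f0 A != 0 -> f A != 0 /\ (side_deg t A + N)%N = m.
  by rewrite ffunE; case: ifP => [/eqP|_]; rewrite ?eqxx.
have b0 : boundary_on (side t) f0 = 0.
  apply/ffunP => A; rewrite [RHS]ffunE; apply/eqP; case: eqVneq => // nz.
  have [k [/eqP kt kA /f0s [fk ek]]] := boundary_on_supp nz.
  have [/andP[kk _] _] := hs _ fk.
  rewrite side_deg_addN ?kt ?negbK // in kk; rewrite side_deg_add // in ek.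
  have := bf _ kk; rewrite (boundary_split t) ffunE (@boundary_on_local (predC (side t)) f 0);
    last first.
    move=> l lt lA; rewrite [RHS]ffunE; apply/eqP; case: eqVneq => // nl.
    have [_] := hs _ nl; rewrite (side_deg_addN (sideN lt)) //; lia.
  rewrite [X in _ + X](_ : _ = 0); last first.
    by rewrite /boundary_on sum_ffunE big1 // => l _; rewrite contract0 ffunE.
  rewrite addr0 => e; move: nz; rewrite (@boundary_on_local (side t) f0 f) ?e ?eqxx //.
  by move=> l /eqP lt lA; rewrite ffunE side_deg_add // ek eqxx.
have hf0 : vertex_chain c m f0 by move=> A /f0s [/hf].
have [x cx [bx sx]] := row_exact hf0 hm b0.
have hx A : x A != 0 -> (q <= side_deg (~~ t) A <= Q)%N /\ (side_deg t A + N)%N = m.+1.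
  move=> /sx [k [kA kt /f0s [nz ek]]]; have [h _] := hs _ nz.
  have kA' : k \notin A :\ k by rewrite !inE eqxx.
  by rewrite -(setD1K kA) side_deg_addN ?kt ?negbK // side_deg_add // addSn ek.
(* The boundary of [x] may leave the half plane; [r] is the part that does, and its boundary
   vanishes inside. *)
pose r : {ffun {set V} -> K} := [ffun A : {set V} =>
  if (q <= side_deg (~~ t) A)%N then 0 else (f - boundary x) A].
pose f' := f - boundary x - r.
have br A : (q <= side_deg (~~ t) A)%N -> boundary r A = 0.
  move=> kA0; apply/eqP; case: eqVneq => // /boundary_supp [k kA]; rewrite ffunE.
  by rewrite side_degU // (leq_trans kA0 (leq_addl _ _)) eqxx.
have f'E A : f' A = if (q <= side_deg (~~ t) A)%N then (f - f0 - boundary_on (predC (side t)) x) A else 0.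
  rewrite /f' (boundary_split t) bx opprD addrA ffunE [(- r) A]ffunE [r A]ffunE.
  by case: ifP => _; rewrite ?subr0 // (boundary_split t) bx opprD addrA subrr.
have [||||w cw [ws bw]] := IH f'.
- move=> A; rewrite f'E; case: ifP => _; rewrite ?eqxx // !ffunE.
  case: (eqVneq (boundary_on (predC (side t)) x A) 0) => [->|/boundary_on_supp [k [kt kA /cx []]]].
    rewrite subr0; case: ifP; rewrite ?subrr ?subr0 ?eqxx // => _ /hf //.
  rewrite cardsU1 kA add1n => -[h] h' _; split=> // v.
  by apply: leq_trans (h' v); rewrite vertex_degU // leq_addl.
- exact: hm.
- move=> A; rewrite f'E; case: ifP => hA; rewrite ?eqxx // !ffunE.
  case: (eqVneq (boundary_on (predC (side t)) x A) 0) => [->|/boundary_on_supp [k [kt kA /hx []]]].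
    rewrite subr0; case: ifP; rewrite ?subrr ?subr0 ?eqxx // => ne nz.
    have [/andP[_ ->] h] := hs _ nz; split=> //; by move: ne h => /eqP; lia.
  have kt' := sideN kt.
  rewrite side_deg_add // side_deg_addN // => /andP[_ h] h' _; split;
    [by rewrite (ltnW h) | by rewrite h'].
- by move=> A hA; rewrite /f' !boundaryB boundary_boundary subr0 ffunE bf // [(- boundary r) A]ffunE br // oppr0 addr0.
exists (w + x); first exact: vertex_chain_add.
split=> A; first by rewrite ffunE; case: (eqVneq (w A) 0) => [->|/ws //]; rewrite add0r => /hx [].
move=> hA; rewrite boundaryD ffunE bw // /f' ffunE [(- r) A]ffunE [r A]ffunE hA subr0.
by rewrite ffunE [(- boundary x) A]ffunE subrK.
Qed.

(** The Koszul complex of the Segre ring in multidegree [(P, c)]: when [P] and [c] have the same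
    sum, these are the sets whose remaining degree is that of a monomial ([segre_deg_realize]). *)
Definition segre_chain c (P : bool -> nat) m f := forall A, f A != 0 ->
  [/\ #|A| = m, forall v, (vertex_deg v A <= c v)%N & forall t, (side_deg t A <= P t)%N].

(** When the two sums agree, the bounds together say that the coefficients have degree at least 2,
    where the quotient by an ideal with linear resolution generated by quadrics has no Koszul
    homology. *)
Lemma segre_exact c P m f :
  (m < P false + P true)%N -> (m.+1 < \sum_v c v)%N ->
  segre_chain c P m f -> boundary f = 0 ->
  exists2 w, segre_chain c P m.+1 w & boundary w = f.
Proof.
move=> hP hc hf bf.
have cf : vertex_chain c m f by move=> A /hf [].
(* The rows bound [f] by some [w1] within the limit on [y]; the columns then remove the part of
   [w1] exceeding the limit on [x]. *)
have [||w1 cw1 [sw1 bw1]] := @half_plane_exact false c m 0 (P true) m.+1 f cf (ltnW hc).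
- by move=> A nz; have [_ _ /(_ true) /= ->] := hf _ nz; split=> //; rewrite addnS ltnS leq_addl.
- by move=> A _; rewrite bf ffunE.
have {}bw1 : boundary w1 = f by apply/ffunP => A; apply: bw1.
pose be : {ffun {set V} ->
  K} := [ffun A : {set V} => if (P false < side_deg false A)%N then w1 A else 0].
have bes A : be A != 0 -> w1 A != 0 /\ (P false < side_deg false A)%N.
  by rewrite ffunE; case: ifP; rewrite ?eqxx.
have cbe : vertex_chain c m.+1 be by move=> A /bes [/cw1].
have [||ga cga [sga bga]] := @half_plane_exact true c m.+1 (P false).+1 m.+2 m.+2 be cbe hc.
- move=> A /bes [nz h]; have [e _] := cw1 _ nz; move: e; rewrite card_side_deg /= h; lia.
- move=> A hA; rewrite (_ : be = w1 - (w1 - be)); last by rewrite opprB addrC subrK.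
  rewrite boundaryB bw1 ffunE; have -> : f A = 0.
    by apply/eqP; case: eqVneq => // /hf [_ _ /(_ false)]; rewrite leqNgt hA.
  rewrite add0r ffunE; apply/eqP; rewrite oppr_eq0; case: eqVneq => // /boundary_supp [k kA].
  by rewrite !ffunE side_degU // (leq_trans hA (leq_addl _ _)) subrr eqxx.
exists (w1 - boundary ga); last by rewrite boundaryB boundary_boundary subr0.
have cw : vertex_chain c m.+1 (w1 - boundary ga) by apply: vertex_chain_add => //;
  apply/vertex_chain_opp/vertex_chain_boundary.
move=> A nz; have [h1 h2] := cw _ nz; split=> //.
have wE : (w1 - boundary ga) A = w1 A - boundary ga A by rewrite ffunE [(- boundary ga) A]ffunE.
rewrite wE in nz.
have le0 : (side_deg false A <= P false)%N.
  rewrite leqNgt; apply/negP => lt; move: nz.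
  by rewrite (bga A lt) ffunE lt subrr eqxx.
case=> //; case: (eqVneq (w1 A) 0) => [z|/sw1 //].
move: nz; rewrite z sub0r oppr_eq0 => /boundary_supp [k kA nz].
(* [k |: A] has [m.+2] elements, more than [P false] of them on the [x] side; the bound on [m]
   leaves at most [P true] for the [y] side. *)
have [e _] := cga _ nz; have [/= /andP[e' _]] := sga _ nz.
have : (side_deg true A <= side_deg true (k |: A))%N by rewrite side_degU // leq_addl.
by move: e; rewrite card_side_deg; lia.
Qed.

End SegreChains.

(** * The Koszul complex of the definitions *)

Section Koszul.
Local Open Scope ring_scope.

Lemma span_ind (K : fieldType) (vT : vectType K) (P : vT -> Prop) (X : seq vT) :
  P 0 -> (forall a x y, x \in X -> P y -> P (a *: x + y)) ->
  forall v, v \in <<X>>%VS -> P v.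
Proof.
move=> P0; elim: X => [|x X IH] PD v; first by rewrite span_nil memv0 => /eqP ->.
rewrite span_cons => /memv_addP [_ /vlineP [a ->] [w wX ->]].
apply: (PD); first by rewrite inE eqxx.
by apply: IH wX => c y z yX; apply: PD; rewrite inE yX orbT.
Qed.

Lemma choice_on (T : eqType) (U : Type) (R : T -> U -> Prop) (s : seq T) :
  U -> (forall x, exists y, R x y) -> exists F : T -> U, forall x, x \in s -> R x (F x).
Proof.
move=> y0 h; elim: s => [|x s [F hF]]; first by exists (fun=> y0).
have [y hy] := h x; exists (fun z => if z == x then y else F z) => z.
by rewrite inE; case: eqP => [-> _|_ /hF].
Qed.

Variables (K : fieldType) (V : finType) (b : nat).
Notation mon := (mon V b).
Notation gen := ((V * V) * (V * V))%type.
Implicit Types (A B : {set V}) (k : V) (u : mon) (e : V -> nat).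
Implicit Types (f : poly_space K V b) (gens : seq gen) (phi psi : kspace K V b).

(** Exponents are unbounded functions, which keeps their arithmetic free of truncation; the value is
    0 as soon as an exponent exceeds [b]. *)
Definition monom e : poly_space K V b := [ffun u : mon => [forall v, u v == e v :> nat]%:R].

Definition exp_add2 e (v1 v2 : V) : V -> nat := fun v => (e v + (v == v1) + (v == v2))%N.

Definition gen_mul e (g : gen) : poly_space K V b :=
  monom (exp_add2 e g.1.1 g.1.2) - monom (exp_add2 e g.2.1 g.2.2).

Lemma mulgenE (m : mon) g : mulgen K m g = gen_mul (fun v => m v) g.
Proof. by apply/ffunP => u; rewrite !ffunE. Qed.

Lemma eq_monom e e' : e =1 e' -> monom e = monom e'.
Proof.
move=> ee; apply/ffunP => u; rewrite !ffunE; congr (_%:R); congr (nat_of_bool _).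
by apply: eq_forallb => v; rewrite ee.
Qed.

Lemma eq_gen_mul e e' g : e =1 e' -> gen_mul e g = gen_mul e' g.
Proof. by move=> ee; congr (_ - _); apply: eq_monom => v; rewrite /exp_add2 ee. Qed.

Definition deg e := (\sum_v e v)%N.

Lemma deg_le e v : (e v <= deg e)%N.
Proof. by rewrite /deg (bigD1 v) //= leq_addr. Qed.

Definition mon_of e : mon := [ffun v => inord (e v)].

Lemma mon_ofE e v : (deg e <= b)%N -> mon_of e v = e v :> nat.
Proof. by move=> h; rewrite ffunE inordK // ltnS; apply: leq_trans (deg_le e v) h. Qed.

Lemma sum_pred1 (v1 : V) : (\sum_v (v == v1) = 1)%N.
Proof. by rewrite (bigD1 v1) //= eqxx big1 ?addn0 // => v /negbTE ->. Qed.

Lemma deg_exp_add2 e v1 v2 : deg (exp_add2 e v1 v2) = (deg e + 2)%N.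
Proof. by rewrite /deg /exp_add2 !big_split /= !sum_pred1 -addnA. Qed.

Lemma monomE e u : monom e u = [forall v, u v == e v :> nat]%:R.
Proof. by rewrite ffunE. Qed.

Lemma monom_supp e u : monom e u != 0 -> forall v, u v = e v :> nat.
Proof. by rewrite monomE; case: forallP => [h _ v|]; [apply/eqP | rewrite eqxx]. Qed.

Lemma monom_sum f : f = \sum_(u : mon) f u *: monom (fun v => u v).
Proof.
apply/ffunP => u; rewrite sum_ffunE (bigD1 u) //= ffunE monomE.
rewrite (introT forallP) //= [_ *: _]mulr1 big1 ?addr0 // => w wu.
rewrite ffunE monomE; case: forallP => h; last by rewrite scaler0.
by move/eqP: wu; case; apply/ffunP => v; apply/val_inj/esym/eqP/h.
Qed.

Lemma gen_mul_mem gens d e g : g \in gens -> (deg e + 2 = d)%N -> (d <= b)%N ->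
  gen_mul e g \in Jdeg K b gens d.
Proof.
move=> edge_gen ed db; have eb : (deg e <= b)%N by lia.
apply: memv_span; apply/allpairsP; exists (mon_of e, g) => /=; split=> //.
  rewrite mem_filter mem_enum andbT -ed eqn_add2r /mdeg /deg; apply/eqP.
  by apply: eq_bigr => v _; rewrite mon_ofE.
by rewrite mulgenE; apply: eq_gen_mul => v; rewrite mon_ofE.
Qed.

Lemma Jdeg_ind gens d (P : poly_space K V b -> Prop) : P 0 ->
  (forall a e g y, g \in gens -> (deg e + 2 = d)%N -> P y -> P (a *: gen_mul e g + y)) ->
  forall f, f \in Jdeg K b gens d -> P f.
Proof.
move=> P0 PD; apply: span_ind => // a x y /allpairsP [[m g] /= [+ edge_gen ->]] Py.
rewrite mem_filter => /andP[/eqP md _]; rewrite mulgenE; exact: PD.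
Qed.

Lemma Jdeg_homog gens d f u : f \in Jdeg K b gens d -> f u != 0 -> mdeg u = d.
Proof.
move=> fJ; move: f fJ u; apply: Jdeg_ind => [u|a e g y _ ed IH u].
  by rewrite ffunE eqxx.
rewrite !ffunE; case: (eqVneq (y u) 0) => [->|/IH //]; rewrite addr0 => nz.
suff [v1 [v2 h]] : exists v1 v2, forall v, u v = exp_add2 e v1 v2 v :> nat.
  by rewrite -ed -(deg_exp_add2 e v1 v2); apply: eq_bigr.
case: (eqVneq (monom (exp_add2 e g.1.1 g.1.2) u) 0) => [z1|/monom_supp];
  last by exists g.1.1, g.1.2.
case: (eqVneq (monom (exp_add2 e g.2.1 g.2.2) u) 0) => [z2|/monom_supp];
  last by exists g.2.1, g.2.2.
by move: nz; rewrite -!monomE z1 z2 subr0 scaler0 eqxx.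
Qed.

Definition slice A phi : poly_space K V b := [ffun u : mon => phi (A, u)].

Lemma sliceD A phi psi : slice A (phi + psi) = slice A phi + slice A psi.
Proof. by apply/ffunP => u; rewrite !ffunE. Qed.

Lemma sliceZ A a phi : slice A (a *: phi) = a *: slice A phi.
Proof. by apply/ffunP => u; rewrite !ffunE. Qed.

Lemma slice0 A : slice A 0 = 0.
Proof. by apply/ffunP => u; rewrite !ffunE. Qed.

Lemma slice_tens A B f : slice A (tens B f) = if A == B then f else 0.
Proof. by apply/ffunP => u; rewrite !ffunE /=; case: ifP; rewrite ?ffunE. Qed.

Lemma tens_sum phi : phi = \sum_A tens A (slice A phi).
Proof.
apply/ffunP => -[A u]; rewrite sum_ffunE (bigD1 A) //= !ffunE /= eqxx big1 ?addr0 //.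
by move=> B BA; rewrite ffunE /= eq_sym (negbTE BA).
Qed.

Lemma Zsp_P gens i d phi : reflect
  (forall A, slice A phi \in Jdeg K b gens d /\ (#|A| != i -> slice A phi = 0))
  (phi \in Zsp K b gens i d).
Proof.
apply: (iffP idP) => [|h].
  move: phi; apply: span_ind => [A|a x y /allpairsP [[B f] /= [+ fb ->]] IH A].
    by rewrite slice0 mem0v.
  rewrite mem_filter => /andP[/eqP Bi _]; have [h1 h2] := IH A.
  rewrite sliceD sliceZ slice_tens; split.
    by rewrite rpredD // rpredZ //; case: ifP => _; [exact: vbasis_mem | exact: mem0v].
  move=> Ai; rewrite h2 // addr0; case: eqP => [e|_]; last by rewrite scaler0.
  by move: Ai; rewrite e Bi eqxx.
rewrite [phi]tens_sum; apply: rpred_sum => A _; have [h1 h2] := h A.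
case: (eqVneq #|A| i) => [Ai|/h2 ->]; last first.
  rewrite (_ : tens A 0 = 0) ?mem0v //.
  by apply/ffunP => p; rewrite !ffunE if_same.
have: slice A phi \in <<vbasis (Jdeg K b gens d)>>%VS by rewrite (span_basis (vbasisP _)).
move: (slice A phi); apply: span_ind => [|a x y xb IH].
  rewrite (_ : tens A 0 = 0) ?mem0v //.
  by apply/ffunP => p; rewrite !ffunE if_same.
rewrite (_ : tens A (a *: x + y) = a *: tens A x + tens A y); last first.
  by apply/ffunP => p; rewrite !ffunE; case: ifP => _; rewrite ?ffunE ?scaler0 ?addr0.
rewrite rpredD // rpredZ //; apply: memv_span; apply/allpairsP; exists (A, x) => /=.
by split=> //; rewrite mem_filter Ai eqxx mem_enum.
Qed.

Definition homog i d phi :=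
  forall A u, phi (A, u) != 0 -> #|A| = i /\ mdeg u = d.

Lemma homogB i d phi psi : homog i d phi -> homog i d psi -> homog i d (phi - psi).
Proof.
move=> h1 h2 A u; rewrite !ffunE; case: (eqVneq (phi (A, u)) 0) => [->|/h1 //].
by rewrite add0r oppr_eq0 => /h2.
Qed.

Lemma Zsp_homog gens i d phi : phi \in Zsp K b gens i d -> homog i d phi.
Proof.
move=> /Zsp_P h A u nz; have [h1 h2] := h A.
have nz' : slice A phi u != 0 by rewrite ffunE.
split; last exact: Jdeg_homog h1 nz'.
by apply/eqP; apply: contraT => /h2 E; move: nz'; rewrite E ffunE eqxx.
Qed.

Fact kdiff_is_linear : linear (@kdiff_fun K V b).
Proof.
move=> a x y; apply/ffunP => p; rewrite !ffunE scaler_sumr -big_split /=.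
by apply: eq_bigr => k _; rewrite !ffunE mulrDr; congr (_ + _);
  rewrite -[LHS]/(_ * (a * _)) -[RHS]/(a * (_ * _)) mulrCA.
Qed.

HB.instance Definition _ :=
  GRing.isLinear.Build K (kspace K V b) (kspace K V b) *:%R (@kdiff_fun K V b) kdiff_is_linear.

Lemma kdiffE phi p : kdiff K V b phi p =
  \sum_(k | (k \notin p.1) && (0 < p.2 k)%N) ksign K k p.1 * phi (k |: p.1, mshift p.2 k).
Proof. by rewrite /kdiff lfunE /= ffunE. Qed.

Lemma mshiftE u k v : mshift u k v = (u v - (v == k))%N :> nat.
Proof. by rewrite ffunE inordK // ltnS (leq_trans (leq_subr _ _)) // -ltnS. Qed.

Lemma mdeg_mshift u k : (0 < u k)%N -> (mdeg (mshift u k)).+1 = mdeg u.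
Proof.
move=> uk; rewrite /mdeg (bigD1 k) //= [RHS](bigD1 k) //= mshiftE eqxx -addSn.
congr (_ + _)%N; first by rewrite subn1 prednK.
by apply: eq_bigr => v /negbTE vk; rewrite mshiftE vk subn0.
Qed.

(** Products whose exponent at [k] would exceed [b] are lost, hence the hypothesis [d < b] in
    [mulx_J]. *)
Definition mulx k f : poly_space K V b :=
  [ffun u : mon => if (0 < u k)%N then f (mshift u k) else 0].

Lemma mulx_monom k e : mulx k (monom e) = monom (fun v => (e v + (v == k))%N).
Proof.
apply/ffunP => u; rewrite !ffunE.
case: posnP => uk.
  case: forallP => // /(_ k); rewrite uk eqxx; lia.
congr (_%:R); congr (nat_of_bool _); apply: eq_forallb => v; rewrite mshiftE.
by case: (eqVneq v k) => [->|]; rewrite ?subn0 ?addn0 //; move: uk; case: (u k : nat) => // n _;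
  lia.
Qed.

Lemma mulxD k f f' : mulx k (f + f') = mulx k f + mulx k f'.
Proof. by apply/ffunP => u; rewrite !ffunE; case: ifP; rewrite ?addr0. Qed.

Lemma mulxZ k a f : mulx k (a *: f) = a *: mulx k f.
Proof. by apply/ffunP => u; rewrite !ffunE; case: ifP; rewrite ?scaler0. Qed.

Lemma mulx_gen_mul k e g : mulx k (gen_mul e g) = gen_mul (fun v => (e v + (v == k))%N) g.
Proof.
rewrite /gen_mul -[- monom _]scaleN1r mulxD mulxZ scaleN1r !mulx_monom.
by congr (_ - _); apply: eq_monom => v; rewrite /exp_add2; lia.
Qed.

Lemma mulx_J gens d k f : (d < b)%N -> f \in Jdeg K b gens d ->
  mulx k f \in Jdeg K b gens d.+1.
Proof.
move=> db; move: f; apply: Jdeg_ind => [|a e g y edge_gen ed IH].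
  rewrite (_ : mulx k 0 = 0) ?mem0v //.
  by apply/ffunP => u; rewrite !ffunE if_same.
rewrite mulxD mulxZ mulx_gen_mul rpredD // rpredZ // gen_mul_mem //.
by rewrite /deg big_split /= sum_pred1 -/(deg e); lia.
Qed.

Lemma slice_kdiff A phi : slice A (kdiff K V b phi) =
  \sum_(k | k \notin A) ksign K k A *: mulx k (slice (k |: A) phi).
Proof.
apply/ffunP => u; rewrite ffunE kdiffE /= sum_ffunE.
rewrite big_mkcondr /=; apply: eq_bigr => k _; rewrite !ffunE.
by case: ifP => _; rewrite ?ffunE ?scaler0.
Qed.

Lemma kdiff_Zsp gens i d phi : (d < b)%N -> phi \in Zsp K b gens i.+1 d ->
  kdiff K V b phi \in Zsp K b gens i d.+1.
Proof.
move=> db /Zsp_P h; apply/Zsp_P => A; rewrite slice_kdiff; split.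
  by apply: rpred_sum => k _; rewrite rpredZ // mulx_J //; case: (h (k |: A)).
move=> Ai; apply: big1 => k kA; have [_ ->] := h (k |: A); last by rewrite cardsU1 kA.
rewrite (_ : mulx k 0 = 0) ?scaler0 //.
by apply/ffunP => u; rewrite !ffunE if_same.
Qed.

Lemma kdiff_homog i d phi : homog i.+1 d phi -> homog i d.+1 (kdiff K V b phi).
Proof.
move=> h A u; rewrite kdiffE /= => nz.
case: (pickP [pred k | [&& k \notin A, (0 < u k)%N & phi (k |: A, mshift u k) != 0]]) => [k|no].
  move=> /and3P[kA uk /h []]; rewrite cardsU1 kA add1n => -[->].
  by move=> md; rewrite -(mdeg_mshift uk) md.
move/eqP: nz; case; apply: big1 => k /andP[kA uk]; move: (no k).
by rewrite /= kA uk /= => /negbFE /eqP ->; rewrite mulr0.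
Qed.

Section Fibers.
Variables (T : eqType) (grade : {set V} -> mon -> T).
Hypothesis grade_inv : forall A u k, k \notin A -> (0 < u k)%N ->
  grade (k |: A) (mshift u k) = grade A u.

(** Monomials of equal grade are identified. For [total] a set and a grade leave at most one
    monomial; for [segre_total] this is the reduction to the Segre ring. *)
Definition fiber_sum (t : T) phi : {ffun {set V} -> K} :=
  [ffun A : {set V} => \sum_(u | grade A u == t) phi (A, u)].

Lemma fiber_sumB t phi psi : fiber_sum t (phi - psi) = fiber_sum t phi - fiber_sum t psi.
Proof. by apply/ffunP => A; rewrite !ffunE -sumrB; apply: eq_bigr => u _; rewrite !ffunE. Qed.

Lemma fiber_sum0 t : fiber_sum t 0 = 0.
Proof. by apply/ffunP => A; rewrite !ffunE big1 // => u _; rewrite ffunE. Qed.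

Lemma fiber_sum_supp t phi A : fiber_sum t phi A != 0 -> exists2 u, grade A u = t & phi (A, u) != 0.
Proof.
rewrite ffunE => nz.
case: (pickP [pred u | (grade A u == t) && (phi (A, u) != 0)]) => [u /andP[/eqP]|no].
  by exists u.
move/eqP: nz; case; apply: big1 => u ut; move: (no u).
by rewrite /= ut /= => /negbFE /eqP.
Qed.

Definition mup u k : mon := [ffun v => inord (u v + (v == k))].

Lemma mupK u k : (u k < b)%N -> mshift (mup u k) k = u.
Proof.
move=> uk; apply/ffunP => v; apply: val_inj; rewrite /= mshiftE ffunE inordK ?addnK //.
by case: eqP => [->|_]; rewrite ?addn1 ?addn0 ?ltn_ord.
Qed.

Lemma mshiftK u k : (0 < u k)%N -> mup (mshift u k) k = u.
Proof.
move=> uk; apply/ffunP => v; apply: val_inj; rewrite /= ffunE mshiftE.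
rewrite subnK; first by rewrite inordK.
by case: eqP => [->|].
Qed.

(** At [u k = b] the index overflows and [inord] returns 0, so positivity of the new exponent
    records that no overflow took place. *)
Lemma mup_top u k : (0 < mup u k k)%N = (u k < b)%N.
Proof.
rewrite ffunE eqxx addn1; case: (ltnP (u k) b) => h; first by rewrite inordK.
have -> : inord (u k).+1 = ord0 :> 'I_b.+1; last by [].
by rewrite /inord /insubd insubN // -leqNgt ltnS.
Qed.

(** Moving [k] from the set to the monomial keeps the grade, so the terms of [kdiff] regroup by
    fibres. *)
Lemma fiber_sum_kdiff t i d phi : homog i d phi -> (i + d <= b)%N ->
  fiber_sum t (kdiff K V b phi) = boundary (fiber_sum t phi).
Proof.
move=> hp idb; apply/ffunP => A; rewrite !ffunE.
under eq_bigr => u _ do rewrite kdiffE /=.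
rewrite (exchange_big_dep (fun k => k \notin A)) /=; last by move=> u k _ /andP[].
apply: eq_bigr => k kA; rewrite ffunE mulr_sumr.
rewrite (reindex_onto (fun u => mup u k) (fun u => mshift u k)); last first.
  by move=> u /and3P[_ _]; apply: mshiftK.
(* A monomial with exponent [b] at [k] has degree at least [b], but [k |: A] already uses one of the
   [i + d <= b] available degrees; such terms vanish. *)
rewrite [RHS](bigID (fun u => (u k < b)%N)) /= [X in _ = _ + X]big1 ?addr0; last first.
  move=> u /andP[_ ub]; case: (eqVneq (phi (k |: A, u)) 0) => [->|/hp [hA hu]].
    by rewrite mulr0.
  move: (deg_le (fun v => u v) k); rewrite /deg -/(mdeg u) hu.
  by move: hA; rewrite cardsU1 kA; lia.
apply: eq_big => [u|u /andP[_ /eqP -> //]].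
rewrite kA mup_top /=; case: ltnP => ub; rewrite ?andbF //= mupK // eqxx !andbT.
by rewrite -(grade_inv kA) ?mupK // mup_top.
Qed.

(* A lift puts each value of a chain of grade [t] on a single monomial of that grade. *)
Lemma exact_lift i d phi : homog i d.+1 phi ->
  (i + d.+1 <= b)%N ->
  (forall t, exists2 w : {ffun {set V} -> K}, boundary w = fiber_sum t phi &
     forall A, w A != 0 -> #|A| = i.+1 /\ exists2 u, grade A u = t & mdeg u = d) ->
  exists2 psi, homog i.+1 d psi & forall t, fiber_sum t (kdiff K V b psi) = fiber_sum t phi.
Proof.
move=> hp idb hw.
(* [T] may be infinite, but only finitely many grades occur, so the bounds [w] can be chosen along
   their list. *)
pose sT := [seq grade p.1 p.2 | p <- enum {: {set V} * mon}].
have [W hW] := @choice_on T _ (fun t w => boundary w = fiber_sum t phi /\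
     forall A, w A != 0 -> #|A| = i.+1 /\ exists2 u, grade A u = t & mdeg u = d) sT 0
     (fun t => let: ex_intro2 w h1 h2 := hw t in ex_intro _ w (conj h1 h2)).
have inT A u : grade A u \in sT by apply/mapP; exists (A, u); rewrite ?mem_enum.
(* The default does not matter: [psi] is supported on monomials of degree [d], and such a monomial
   is itself a candidate for the pick. *)
pose can A t := odflt [ffun=> ord0] [pick u | (grade A u == t) && (mdeg u == d)].
pose psi : kspace K V b := [ffun p => if (p.2 == can p.1 (grade p.1 p.2)) && (mdeg p.2 == d)
   then W (grade p.1 p.2) p.1 else 0].
have hpsi : homog i.+1 d psi.
  move=> A u; rewrite ffunE /=; case: ifP; rewrite ?eqxx // => /andP[_ /eqP ud] nz.
  by have [_ /(_ _ nz) []] := hW _ (inT A u).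
exists psi => // t; rewrite (fiber_sum_kdiff _ hpsi); last by lia.
have [tin|tout] := boolP (t \in sT); last first.
  have E q : fiber_sum t q = 0.
    apply/ffunP => A; rewrite !ffunE big1 // => u /eqP e.
    by move: tout; rewrite -e inT.
  by rewrite !E boundary0.
have [<- h2] := hW _ tin; congr boundary; apply/ffunP => A; rewrite ffunE.
have Eu u : grade A u == t -> psi (A, u) =
    if (u == can A t) && (mdeg u == d) then W t A else 0.
  by move=> /eqP ut; rewrite ffunE /= ut.
rewrite (eq_bigr _ Eu) -big_mkcondr /=.
case: (eqVneq (W t A) 0) => [->|/h2 [_ [u ut ud]]]; first by rewrite big1.
have [c1 c2] : grade A (can A t) = t /\ mdeg (can A t) = d.
  rewrite /can; case: pickP => [v /= /andP[/eqP -> /eqP ->] //|/(_ u)].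
  by rewrite ut ud !eqxx.
rewrite (big_pred1 (can A t)) // => v /=; case: (eqVneq v (can A t)) => [->|_].
  by rewrite c1 c2 !eqxx.
by rewrite andbF.
Qed.
End Fibers.

Definition total A u : {ffun V -> nat} := [ffun v => ((v \in A) + u v)%N].

Lemma total_inv A u k : k \notin A -> (0 < u k)%N ->
  total (k |: A) (mshift u k) = total A u.
Proof.
move=> kA uk; apply/ffunP => v; rewrite !ffunE !inE.
rewrite inordK; last by rewrite ltnS (leq_trans (leq_subr _ _)) // -ltnS.
by case: eqP => [->|_] /=; rewrite ?(negbTE kA) ?subn0 //= subn1 add0n add1n prednK.
Qed.

Lemma fiber_sum_total A u phi : fiber_sum total (total A u) phi A = phi (A, u).
Proof.
rewrite ffunE (big_pred1 u) // => w; apply/eqP/eqP => [e|-> //].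
by apply/ffunP => v; apply: val_inj; move/ffunP/(_ v): e; rewrite !ffunE => /addnI.
Qed.

Lemma kdiff_kdiff i d phi : homog i.+1 d phi -> (i.+1 + d <= b)%N ->
  kdiff K V b (kdiff K V b phi) = 0.
Proof.
move=> hp idb; apply/ffunP => -[A u]; rewrite -fiber_sum_total [RHS]ffunE.
rewrite (fiber_sum_kdiff total_inv _ (kdiff_homog hp)); last by lia.
by rewrite (fiber_sum_kdiff total_inv _ hp) // boundary_boundary ffunE.
Qed.

(** In multidegree [t] the admissible sets are all subsets of the support of [t]. The positive
    degree [d.+1] provides some [k] in the support, and wedging with [k] contracts the strand. *)
Lemma kdiff_exact i d phi : homog i d.+1 phi -> (i + d.+1 <= b)%N ->
  kdiff K V b phi = 0 -> exists2 psi, homog i.+1 d psi & kdiff K V b psi = phi.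
Proof.
move=> hp idb dp.
have [|psi hpsi E] := exact_lift total_inv hp idb; last first.
  by exists psi => //; apply/ffunP => -[A u]; rewrite -fiber_sum_total E fiber_sum_total.
move=> t; set f := fiber_sum total t phi.
have bf : boundary f = 0 by rewrite -(fiber_sum_kdiff total_inv _ hp) // dp fiber_sum0.
case: (pickP [pred A | f A != 0]) => [A /= nz|no]; last first.
  exists 0; last by move=> A; rewrite ffunE eqxx.
  by rewrite boundary0; apply/ffunP => A; rewrite [LHS]ffunE; move: (no A) => /= /negbFE /eqP ->.
have [u ut /hp [_ ud]] := fiber_sum_supp nz.
have [k uk] : exists k, (0 < u k)%N.
  case: (pickP [pred k | 0 < u k]%N) => [k /= h|no]; first by exists k.
  by move: ud; rewrite /mdeg big1 // => v _; move: (no v) => /=; lia.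
have tk : (0 < t k)%N by rewrite -ut ffunE; lia.
exists (wedge k f); first by rewrite boundary_wedge bf wedge0 subr0.
move=> B /wedge_supp [kB /fiber_sum_supp [w wt /hp [hB hw]]].
have kB' : k \notin B :\ k by rewrite !inE eqxx.
split; first by rewrite (cardsD1 k) kB hB.
have wk : (0 < w k)%N by move: tk; rewrite -wt ffunE (negbTE kB').
exists (mshift w k); last by apply: succn_inj; rewrite mdeg_mshift.
by rewrite -wt -(total_inv kB' wk) setD1K.
Qed.

End Koszul.

(** * Vanishing Betti numbers as exact strands *)

Section Betti.
Local Open Scope ring_scope.
Variables (K : fieldType) (V : finType) (gens : seq ((V * V) * (V * V))).

Definition exactK i d := forall phi : kspace K V (i + d),
  phi \in Zsp K (i + d) gens i d -> kdiff K V (i + d) phi = 0 ->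
  exists2 psi, psi \in Zsp K (i + d) gens i.+1 d.-1 & kdiff K V (i + d) psi = phi.

Lemma Jdeg0 b d : (d < 2)%N -> Jdeg K b gens d = 0%VS.
Proof.
move=> d2; apply/eqP; rewrite -subv0; apply/subvP; apply: Jdeg_ind => [|a e g y _ ed _].
  exact: mem0v.
by lia.
Qed.

(** The subtraction of dimensions in [betti] is truncated; since boundaries are cycles ([sub]), its
    vanishing still means equality of the two spaces. *)
Lemma betti_exact i d : betti K gens i (i + d) = 0%N <-> exactK i d.
Proof.
rewrite /betti leq_addr addKn.
set D := kdiff K V _; set Z := Zsp K _ gens i d; set Z' := Zsp K _ gens i.+1 d.-1.
have sub : (D @: Z' <= lker D :&: Z)%VS.
  apply/subvP => _ /memv_imgP [psi hp ->]; rewrite memv_cap memv_ker.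
  (* For [d = 0] the truncated [d.-1] places [Z'] in degree 0 instead of -1, which is harmless
     because the ideal is 0 below degree 2. *)
  case: d @D @Z @Z' psi hp => [|d] /= psi hp.
    suff -> : psi = 0 by rewrite !linear0 mem0v eqxx.
    rewrite [psi]tens_sum big1 // => A _; have [+ _] := Zsp_P _ _ _ _ hp A.
    rewrite Jdeg0 // memv0 => /eqP ->; by apply/ffunP => p; rewrite !ffunE if_same.
  rewrite (kdiff_kdiff (Zsp_homog hp)) ?eqxx //=; last by lia.
  by apply: kdiff_Zsp hp; lia.
split=> [/eqP|ex].
  rewrite subn_eq0 => le phi pZ pD.
  have /subvP/(_ phi) : (lker D :&: Z <= D @: Z')%VS.
    by rewrite -(geq_leqif (dimv_leqif_sup sub)).
  by rewrite memv_cap memv_ker pD eqxx pZ => /(_ isT) /memv_imgP [psi h ->]; exists psi.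
apply/eqP; rewrite subn_eq0; apply: dimvS; apply/subvP => phi.
rewrite memv_cap memv_ker => /andP[/eqP pD pZ].
by have [psi h <-] := ex _ pZ pD; apply: memv_img.
Qed.
End Betti.

(** * Complete graphs *)

Section Segre.
Local Open Scope ring_scope.
Variables (K : fieldType) (n : nat).
Notation V := ('I_n * bool)%type.
Implicit Types (i j v : 'I_n) (t : bool) (k : V) (e : V -> nat) (g : rel 'I_n).

Definition edge_gen i j : (V * V) * (V * V) :=
  (((i, false), (j, true)), ((j, false), (i, true))).

Definition complete_rel : rel 'I_n := fun i j => i != j.

Lemma bei_gensP g x : reflect (exists i j, [/\ g i j, (i < j)%N & x = edge_gen i j]) (x \in bei_gens g).
Proof.
apply: (iffP mapP) => [[[i j]]|[i [j [gij ij ->]]]].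
  by rewrite mem_filter /= => /andP[/andP[gij ij] _] ->; exists i, j.
exists (i, j) => //; rewrite mem_filter /= gij ij /=.
by apply/allpairsP; exists (i, j); rewrite !mem_enum.
Qed.

Lemma gen_mul_edge_genC b m i j : gen_mul K b m (edge_gen j i) = - gen_mul K b m (edge_gen i j).
Proof.
rewrite /gen_mul /edge_gen /= opprB; congr (_ - _); apply: eq_monom => v;
  by rewrite /exp_add2 addnAC.
Qed.

Lemma swapJ b d g m i j : symmetric g -> g i j -> i != j ->
  (deg m + 2 = d)%N -> (d <= b)%N -> gen_mul K b m (edge_gen i j) \in Jdeg K b (bei_gens g) d.
Proof.
move=> gs gij; rewrite neq_ltn => /orP[ij|ji] md db.
  by apply: gen_mul_mem => //; apply/bei_gensP; exists i, j.
rewrite gen_mul_edge_genC rpredN; apply: gen_mul_mem => //; apply/bei_gensP; exists j, i.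
by rewrite gs.
Qed.

Lemma complete_rel_sym : symmetric complete_rel. Proof. by move=> i j;
  rewrite /complete_rel eq_sym. Qed.

(** The exponents of the image of a monomial under [x_v -> s t_v], [y_v -> s' t_v]. *)
Definition segre_deg e : {ffun bool -> nat} * {ffun 'I_n -> nat} :=
  ([ffun t => \sum_v e (v, t)]%N, [ffun v => e (v, false) + e (v, true)]%N).

Lemma deg_segre_deg2 e : deg e = (\sum_v (segre_deg e).2 v)%N.
Proof.
rewrite /deg (eq_bigr (fun k => e (k.1, k.2))); last by case.
rewrite -(pair_bigA _ (fun v t => e (v, t))) /=; apply: eq_bigr => v _.
by rewrite ffunE big_bool addnC.
Qed.

Lemma deg_segre_deg1 e : deg e = ((segre_deg e).1 false + (segre_deg e).1 true)%N.
Proof.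
rewrite deg_segre_deg2 !ffunE -big_split /=; apply: eq_bigr => v _; by rewrite ffunE.
Qed.

Lemma eq_segre_deg e e' : e =1 e' -> segre_deg e = segre_deg e'.
Proof.
move=> E; congr (_, _); apply/ffunP => x; rewrite !ffunE ?E //.
by apply: eq_bigr => v _; rewrite E.
Qed.

Lemma sum_pair t k : (\sum_(v : 'I_n) (((v, t) == k) : nat) = (t == k.2))%N.
Proof.
case: k => w s /=; rewrite (bigD1 w) //= big1 ?addn0 ?xpair_eqE ?eqxx //.
by move=> v /negbTE vw; rewrite xpair_eqE vw.
Qed.

Lemma segre_deg_edge_gen m i j :
  segre_deg (exp_add2 m (i, false) (j, true)) = segre_deg (exp_add2 m (j, false) (i, true)).
Proof.
congr (_, _); apply/ffunP => x; rewrite !ffunE /exp_add2.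
  by rewrite !big_split /= !sum_pair.
by rewrite !xpair_eqE !andbF !andbT; lia.
Qed.

Lemma sum_monom b (P : pred (mon V b)) e : (deg e <= b)%N ->
  \sum_(u | P u) monom K b e u = (P (mon_of b e))%:R.
Proof.
move=> eb; have hm (k : V) : mon_of b e k = e k :> nat by apply: mon_ofE.
case: (boolP (P (mon_of b e))) => Pm.
  rewrite (bigD1 (mon_of b e)) //= monomE (introT forallP); last by move=> v; rewrite hm.
  rewrite big1 ?addr0 // => u /andP[_ /eqP um]; rewrite monomE; case: forallP => // h.
  by case: um; apply/ffunP => v; apply: val_inj; rewrite /= hm; apply/eqP/h.
rewrite big1 // => u Pu; rewrite monomE; case: forallP => // h.
suff E : u = mon_of b e by move: Pm; rewrite -E Pu.
by apply/ffunP => v; apply: val_inj; rewrite /= hm; apply/eqP/h.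
Qed.

(** The two monomials of a minor have the same image in the Segre ring, so the ideal of any graph
    lies in the kernel of the Segre map. *)
Lemma Jdeg_fiber_sum b d g (f : poly_space K V b) : (d <= b)%N -> f \in Jdeg K b (bei_gens g) d ->
  forall s, \sum_(u : mon V b | segre_deg (fun k => u k) == s) f u = 0.
Proof.
move=> db fJ s; move: f fJ; apply: Jdeg_ind => [|a m x y /bei_gensP [i [j [_ _ ->]]] md IH].
  by rewrite big1 // => u _; rewrite ffunE.
rewrite (eq_bigr (fun u : mon V b => a *: (monom K b (exp_add2 m (i, false) (j, true)) u
   - monom K b (exp_add2 m (j, false) (i, true)) u) + y u)); last by move=> u _; rewrite !ffunE.
rewrite big_split /= -scaler_sumr sumrB IH addr0 !sum_monom ?deg_exp_add2 ?md //.
rewrite (eq_segre_deg (e' := exp_add2 m (i, false) (j, true))); last first.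
  by move=> v; rewrite mon_ofE // deg_exp_add2 md.
rewrite [X in _ - X](_ : _ = (segre_deg (exp_add2 m (j, false) (i, true)) == s)%:R).
  by rewrite segre_deg_edge_gen subrr scaler0.
by congr (_ == s)%:R; apply: eq_segre_deg => v; rewrite mon_ofE // deg_exp_add2 md.
Qed.

Lemma segre_deg_xsum e e' : segre_deg e = segre_deg e' ->
  (\sum_v e (v, false) = \sum_v e' (v, false))%N.
Proof. by case=> /ffunP/(_ false) + _; rewrite !ffunE. Qed.

Lemma segre_deg_vertex e e' v : segre_deg e = segre_deg e' ->
  (e (v, false) + e (v, true) = e' (v, false) + e' (v, true))%N.
Proof. by case=> _ /ffunP/(_ v); rewrite !ffunE. Qed.

Lemma segre_deg_le_eq e e' : segre_deg e = segre_deg e' ->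
  (forall v, (e (v, false) <= e' (v, false))%N) -> e =1 e'.
Proof.
move=> se le.
have ef v : e (v, false) = e' (v, false).
  apply/eqP; rewrite eqn_leq le /= leqNgt; apply/negP => lt.
  have : (\sum_v e (v, false) < \sum_v e' (v, false))%N; last by rewrite (segre_deg_xsum se) ltnn.
  by rewrite (bigD1 v) //= [X in (_ < X)%N](bigD1 v) //= -addSn leq_add // leq_sum.
by case=> v [] //; have := segre_deg_vertex v se; rewrite ef => /addnI.
Qed.

(** Induction on the excess of the [x] exponents of [e] over those of [e']: replacing a factor
    [x_i y_j] by [x_j y_i], with [i] in excess and [j] in deficit, changes the monomial by a minor
    and lowers the excess. *)
Lemma segre_deg_congr b d N : forall e e', segre_deg e = segre_deg e' -> deg e = d -> (d <= b)%N ->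
  (\sum_v (e (v, false) - e' (v, false)) <= N)%N ->
  monom K b e - monom K b e' \in Jdeg K b (bei_gens complete_rel) d.
Proof.
elim: N => [|N IH] e e' se ed db hN.
  rewrite (eq_monom K b (e' := e')) ?subrr ?mem0v //; apply: segre_deg_le_eq => // v.
  by move: hN; rewrite (bigD1 v) //=; lia.
case: (pickP [pred v | e' (v, false) < e (v, false)]%N) => [i /= hi|no]; last first.
  rewrite (eq_monom K b (e' := e')) ?subrr ?mem0v //; apply: segre_deg_le_eq => // v.
  by move: (no v) => /=; lia.
case: (pickP [pred v | e (v, false) < e' (v, false)]%N) => [j /= hj|no]; last first.
  move: hi; rewrite (segre_deg_le_eq (esym se)) ?ltnn // => v; move: (no v) => /=; lia.
have sc v := segre_deg_vertex v se.
have ij : i != j by apply: contraTneq hi => ->; lia.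
(* [e] is divisible by [x_i y_j]: its [x] exponent at [j] is below that of [e'], so by the equal
   sums over [j] its [y] exponent is above. *)
pose m k := (e k - (k == (i, false)) - (k == (j, true)))%N.
pose e1 := exp_add2 m (j, false) (i, true).
have em k : e k = exp_add2 m (i, false) (j, true) k.
  rewrite /exp_add2 /m; have scj := sc j.
  case: (eqVneq k (i, false)) => [->|_]; last first.
    by case: (eqVneq k (j, true)) => [->|_] /=; lia.
  by rewrite !xpair_eqE /= !andbF /=; lia.
have md : (deg m + 2 = d)%N.
  by rewrite -(deg_exp_add2 m (i, false) (j, true)) -ed; apply: eq_bigr => k _; rewrite em.
have -> : monom K b e - monom K b e' = gen_mul K b m (edge_gen i j) + (monom K b e1 - monom K b e').
  by rewrite /gen_mul /= -(eq_monom K b em) addrA subrK.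
rewrite rpredD //; first by apply: swapJ => //; exact: complete_rel_sym.
apply: IH => //.
- by rewrite -se (eq_segre_deg em) segre_deg_edge_gen.
- by rewrite /e1 deg_exp_add2.
have e1i v : e1 (v, false) = (e (v, false) - (v == i) + (v == j))%N.
  by rewrite /e1 /exp_add2 /m !xpair_eqE /= !andbF !andbT /= subn0 addn0.
rewrite -ltnS; apply: leq_trans hN.
rewrite (bigD1 i) //= [X in (_ < X)%N](bigD1 i) //= e1i eqxx (negbTE ij) addn0.
rewrite -addSn leq_add //; first by lia.
apply: leq_sum => v /negbTE vi; rewrite e1i vi.
by case: (eqVneq v j) => [->|] /=; lia.
Qed.

(** Replacing each monomial by a representative of its fibre changes [f] by an element of the ideal,
    and afterwards the coefficients in each fibre add up to 0. So the ideal of the complete graph is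
    the whole kernel of the Segre map. *)
Lemma fiber_sum_Jdeg b d (f : poly_space K V b) : (d <= b)%N ->
  (forall u, f u != 0 -> mdeg u = d) ->
  (forall s, \sum_(u : mon V b | segre_deg (fun k => u k) == s) f u = 0) ->
  f \in Jdeg K b (bei_gens complete_rel) d.
Proof.
move=> db fd fs; pose s (u : mon V b) := segre_deg (fun k => u k).
pose can (u : mon V b) := odflt u [pick w | s w == s u].
have canE u w : s u = s w -> can u = can w.
  move=> E; rewrite /can E; case: pickP => // /(_ w); by rewrite eqxx.
have can_s u : s (can u) = s u by rewrite /can; case: pickP => //= w /eqP.
have E : \sum_u f u *: monom K b (fun k => can u k) = 0.
  apply/ffunP => w; rewrite sum_ffunE ffunE.
  rewrite (eq_bigr (fun u => if w == can u then f u else 0)); last first.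
    move=> u _; rewrite ffunE monomE; case: forallP => h.
      rewrite (_ : w = can u) ?eqxx; first by rewrite [_ *: _]mulr1.
      by apply/ffunP => v; apply: val_inj; apply/eqP/h.
    by case: eqP => [wu|_]; [case: h => v; rewrite wu | rewrite scaler0].
  rewrite -big_mkcond /=; case: (eqVneq w (can w)) => [wc|wc].
    rewrite -[RHS](fs (s w)); apply: eq_bigl => u; apply/eqP/eqP => [->|/canE -> //].
    by rewrite can_s.
  apply: big1 => u /eqP wu; case/eqP: wc; rewrite {1}wu; apply: canE.
  by rewrite wu can_s.
rewrite [f]monom_sum -[X in X \in _]subr0 -{2}E -sumrB; apply: rpred_sum => u _.
rewrite -scalerBr; case: (eqVneq (f u) 0) => [->|/fd ud]; first by rewrite scale0r mem0v.
by rewrite rpredZ //; apply: segre_deg_congr => //; rewrite -/(s _) can_s.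
Qed.

Definition segre_total (A : {set V}) b (u : mon V b) : {ffun bool -> nat} * {ffun 'I_n -> nat} :=
  ([ffun t => side_deg t A + (segre_deg (fun k => u k)).1 t]%N,
   [ffun v => vertex_deg v A + (segre_deg (fun k => u k)).2 v]%N).

Lemma segre_total_inv b (A : {set V}) (u : mon V b) k : k \notin A -> (0 < u k)%N ->
  segre_total (k |: A) (mshift u k) = segre_total A u.
Proof.
move=> kA uk; congr (_, _); apply/ffunP => x; rewrite !ffunE.
  rewrite side_degU // eq_sym -(sum_pair x k) [X in (X + _)%N]addnC -addnA -big_split /=.
  congr (_ + _)%N; apply: eq_bigr => v _; rewrite mshiftE.
  by case: eqP => [->|_] /=; rewrite ?subn0 // subnKC.
have mE y : (inord (u y - (y == k)) : 'I_b.+1) = (u y - (y == k))%N :> nat.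
  by rewrite -[RHS]mshiftE ffunE.
rewrite vertex_degU // !mE; case: k kA uk {mE} => w t _ uk /=; rewrite !xpair_eqE.
case: (eqVneq w x) => [<-|wx] /=; rewrite ?eqxx /=; last first.
  by rewrite !subn0.
by case: t uk => /=; lia.
Qed.

Lemma sum_below c (p : nat) : (p <= \sum_(v : 'I_n) c v)%N ->
  exists2 x, (forall v, x v <= c v)%N & (\sum_v x v = p)%N.
Proof.
elim: p => [|p IH] hp; first by exists (fun=> 0%N); rewrite ?big1.
have [x xc xp] := IH (ltnW hp).
case: (pickP [pred v | x v < c v]%N) => [w /= hw|no].
  exists (fun v => x v + (v == w))%N; last by rewrite big_split /= sum_pred1 xp addn1.
  by move=> v; case: eqP => [->|_]; rewrite ?addn1 ?addn0.
move: hp; rewrite -xp ltnNge leq_sum // => v _; move: (no v) => /=; lia.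
Qed.

(** A two-row contingency table with prescribed margins: the [x] row is chosen below the column
    sums, and the [y] row takes the rest. *)
Lemma segre_deg_realize (P : bool -> nat) (c : 'I_n -> nat) :
  (\sum_v c v = P false + P true)%N ->
  exists e, (forall t, (segre_deg e).1 t = P t) /\ (forall v, (segre_deg e).2 v = c v).
Proof.
move=> h; have [|x xc xP] := @sum_below c (P false); first by rewrite h leq_addr.
exists (fun k => if k.2 then c k.1 - x k.1 else x k.1)%N; split=> y; rewrite ffunE /=.
  case: y => //=; apply/eqP; rewrite -(eqn_add2l (P false)) -h -xP -big_split /=.
  by apply/eqP/eq_bigr => v _; rewrite subnKC.
by rewrite subnKC.
Qed.

(* The linear resolution of the ideal of all 2-minors. A cycle is bounded over the
   polynomial ring, and the bound is corrected inside the coordinate ring of the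
   Segre variety, whose Koszul complex in a fixed multidegree is a complex of
   simplicial chains. *)
Lemma complete_exact (i d : nat) : (3 <= d)%N -> exactK K (bei_gens complete_rel) i d.
Proof.
move=> d3 phi pZ pD; case: d d3 phi pZ pD => [|[|d]] // d3 phi pZ pD /=.
have ph := Zsp_homog pZ.
have [psi hpsi psiD] := kdiff_exact ph (leqnn _) pD.
set b := (i + d.+2)%N in phi pZ pD ph psi hpsi psiD *.
have ib : (i.+1 + d.+1 <= b)%N by rewrite /b; lia.
have [|chi hchi E] := exact_lift (@segre_total_inv b) hpsi ib.
  move=> s; set f := fiber_sum _ s psi.
  case: (pickP [pred A | f A != 0]) => [A /= nz|no]; last first.
    exists 0; last by move=> A; rewrite ffunE eqxx.
    by rewrite boundary0; apply/ffunP => A; rewrite [LHS]ffunE; move: (no A) => /= /negbFE /eqP ->.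
  have tot B (u : mon V b) : (\sum_v (segre_total B u).2 v = #|B| + mdeg u)%N /\
      ((segre_total B u).1 false + (segre_total B u).1 true = #|B| + mdeg u)%N.
    rewrite -[mdeg u]/(deg (fun k => u k)); split.
      rewrite [in RHS]deg_segre_deg2 -sum_vertex_deg -big_split /=.
      by apply: eq_bigr => v _; rewrite ffunE.
    by rewrite [in RHS]deg_segre_deg1 card_side_deg !ffunE -!/(segre_deg _); lia.
  have [s1 s2] : (\sum_v s.2 v = b)%N /\ (s.1 false + s.1 true = b)%N.
    have [u <- /hpsi [hA hu]] := fiber_sum_supp nz; have [-> ->] := tot A u.
    by rewrite hA hu; split; rewrite /b; lia.
  (* The differential of [psi] is [phi], whose coefficients lie in the ideal and hence have fibre
     sums 0. *)
  have bf : boundary f = 0.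
    rewrite -(fiber_sum_kdiff (@segre_total_inv b) _ hpsi) // psiD; apply/ffunP => B;
      rewrite !ffunE.
    case: (pickP [pred u : mon V b | segre_total B u == s]) => [u /= /eqP us|no];
      last by rewrite big_pred0.
    have /Zsp_P/(_ B) [/Jdeg_fiber_sum J _] := pZ.
    rewrite -[RHS](J _ (segre_deg (fun k => u k))); last by rewrite /b; lia.
    rewrite [RHS](eq_bigr (fun w => phi (B, w))); last by move=> w _; rewrite ffunE.
    apply: eq_bigl => w; rewrite -us /segre_total.
    apply/eqP/eqP => [[/ffunP e1 /ffunP e2]|-> //].
    congr (_, _); apply/ffunP => x.
      by move: (e1 x); rewrite !ffunE => /addnI.
    by move: (e2 x); rewrite !ffunE => /addnI.
  have cf : segre_chain s.2 s.1 i.+1 f.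
    move=> B /fiber_sum_supp [u <- /hpsi [hB _]]; split=> //.
      by move=> v; rewrite ffunE leq_addr.
    by move=> t; rewrite ffunE leq_addr.
  (* The coefficients of [psi] have degree [d.+1], at least 2 by [d3]; both bounds follow from
     this. *)
  have [||w cw bw] := segre_exact _ _ cf bf.
  - by rewrite s2 /b; lia.
  - by rewrite s1 /b; lia.
  exists w => // B /cw [hB h1 h2]; split=> //.
  (* Each set in the support of [w] is completed by a monomial that absorbs the degrees it
     leaves. *)
  have [|e [e1 e2]] := @segre_deg_realize (fun t => s.1 t - side_deg t B)%N (fun v =>
    s.2 v - vertex_deg v B)%N.
    rewrite sumnB // sum_vertex_deg s1 -s2 card_side_deg.
    by have := h2 false; have := h2 true; lia.
  have de : deg e = d.
    rewrite deg_segre_deg2 (eq_bigr _ (fun v _ => e2 v)) sumnB // sum_vertex_deg s1 hB /b; lia.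
  have ue : segre_deg (fun k => mon_of b e k) = segre_deg e.
    by apply: eq_segre_deg => v; rewrite mon_ofE // de /b; lia.
  exists (mon_of b e).
    rewrite /segre_total ue; case: (s) s1 s2 h1 h2 e1 e2 {cf f nz bf cw bw} =>
      s1 s2 /= _ _ h1 h2 e1 e2.
    by congr (_, _); apply/ffunP => x; rewrite ffunE ?e1 ?e2 subnKC.
  by rewrite -de; apply: eq_bigr => v _; rewrite mon_ofE // de /b; lia.
have hD : homog i.+1 d.+1 (kdiff K V b chi) := kdiff_homog hchi.
exists (psi - kdiff K V b chi); last first.
  by rewrite linearB /= psiD (kdiff_kdiff hchi) ?subr0 // /b; lia.
have hd := homogB hpsi hD.
apply/Zsp_P => A; split; last first.
  move=> Ai; apply/ffunP => u; rewrite !ffunE; apply/eqP; case: eqVneq => // nz.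
  by move: Ai; have [|-> _] := hd A u; rewrite ?eqxx // !ffunE.
apply: fiber_sum_Jdeg; first by rewrite /b; lia.
  by move=> u; rewrite ffunE => /hd [].
move=> s.
rewrite (eq_bigr (fun u => (psi - kdiff K V b chi) (A, u))); last by move=> u _; rewrite ffunE.
case: (pickP [pred u : mon V b | segre_deg (fun k => u k) == s]) => [u /= /eqP us|no];
  last by rewrite big_pred0.
transitivity (fiber_sum (@segre_total^~ b) (segre_total A u) (psi - kdiff K V b chi) A); last first.
  by rewrite fiber_sumB E subrr ffunE.
rewrite [RHS]ffunE; apply: eq_bigl => w; rewrite -us /segre_total.
apply/eqP/eqP => [-> //|[/ffunP e1 /ffunP e2]].
congr (_, _); apply/ffunP => x.
  by move: (e1 x); rewrite !ffunE => /addnI.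
by move: (e2 x); rewrite !ffunE => /addnI.
Qed.

End Segre.

(** * Restriction to an induced subgraph *)

Lemma index_allpairs (S T : eqType) (s : seq S) (r : seq T) x y :
  x \in s -> y \in r ->
  index (x, y) [seq (a, c) | a <- s, c <- r] = index x s * size r + index y r.
Proof.
move=> + yr; elim: s => [//|z s IH]; rewrite inE /= index_cat size_map (eq_sym z x).
case: (eqVneq x z) => [-> _|xz /= xs].
  by rewrite map_f // index_map // => ? ? [].
have -> : (x, y) \in [seq (z, c) | c <- r] = false.
  by apply/negbTE/mapP => -[c _ [e _]]; rewrite e eqxx in xz.
by rewrite IH // mulSn addnA.
Qed.

(** Koszul signs compare ranks of variables. The formula shows that this order is lexicographic with
    the vertex first, so an increasing map of vertices preserves the signs. *)
Lemma enum_rank_pair n (a : 'I_n * bool) :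
  enum_rank a = a.1 * 2 + index a.2 (enum {: bool}) :> nat.
Proof.
have eE : enum {: 'I_n * bool} = [seq (i, t) | i <- enum 'I_n, t <- enum {: bool}].
  by rewrite enumT unlock.
have -> : enum_rank a = index a (enum {: 'I_n * bool}) :> nat.
  by rewrite -[X in index X _](nth_enum_rank a a) index_uniq -?cardE ?enum_uniq.
case: a => i t; rewrite eE index_allpairs ?mem_enum //= -cardE card_bool.
by rewrite index_enum_ord.
Qed.

Section Transfer.
Local Open Scope ring_scope.
Variables (K : fieldType) (n1 n : nat) (f : 'I_n1 -> 'I_n).
Variables (g1 : rel 'I_n1) (g : rel 'I_n).
Hypothesis fmono : forall i j, (f i < f j)%N = (i < j)%N.
Hypothesis fg : forall i j, g (f i) (f j) = g1 i j.
Notation V1 := ('I_n1 * bool)%type.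
Notation V := ('I_n * bool)%type.
Implicit Types (A : {set V1}) (B : {set V}) (a c : V1) (k : V).

Definition vmap a : V := (f a.1, a.2).

Lemma fmono_inj : injective f.
Proof.
move=> i j e; apply: val_inj; case: (ltngtP i j) => // h.
  by have := fmono i j; rewrite h e ltnn.
by have := fmono j i; rewrite h e ltnn.
Qed.

Lemma vmap_inj : injective vmap.
Proof. by move=> [i t] [j s] [/fmono_inj -> ->]. Qed.

Lemma rank_vmap a c :
  (enum_rank (vmap a) < enum_rank (vmap c))%N = (enum_rank a < enum_rank c)%N.
Proof.
rewrite !enum_rank_pair /=.
have ib (t : bool) : (index t (enum {: bool}) < 2)%N by rewrite -card_bool cardE index_mem mem_enum.
have := ib a.2; have := ib c.2.
have := fmono a.1 c.1; have := fmono c.1 a.1; have := @fmono_inj a.1 c.1.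
case: (ltngtP a.1 c.1) => [h|h|/val_inj ->] _ h1 h2 i1 i2; last by lia.
all: by lia.
Qed.

Definition pinv k : option V1 := [pick a | vmap a == k].

Lemma pinv_vmap a : pinv (vmap a) = Some a.
Proof.
by rewrite /pinv; case: pickP => [c /eqP/vmap_inj ->|/(_ a)] //; rewrite eqxx.
Qed.

Lemma pinvP k a : pinv k = Some a -> k = vmap a.
Proof. by rewrite /pinv; case: pickP => // c /eqP <- [->]. Qed.

Definition outside k := ~~ pinv k.

Lemma outside_vmap a : outside (vmap a) = false. Proof. by rewrite /outside pinv_vmap. Qed.

Definition extend_exp (e : V1 -> nat) k : nat := if pinv k is Some a then e a else 0%N.

Lemma extend_exp_vmap e a :
  extend_exp e (vmap a) = e a. Proof. by rewrite /extend_exp pinv_vmap. Qed.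
Lemma extend_exp_outside e k : outside k ->
  extend_exp e k = 0%N. Proof. by rewrite /extend_exp /outside; case: pinv. Qed.

Lemma extend_exp_add2 e a c :
  extend_exp (exp_add2 e a c) =1 exp_add2 (extend_exp e) (vmap a) (vmap c).
Proof.
move=> k; rewrite /exp_add2 /extend_exp; case E: (pinv k) => [x|].
  by rewrite (pinvP E) !(inj_eq vmap_inj).
have o x : (k == vmap x) = false by apply/eqP => e'; move: E; rewrite e' pinv_vmap.
by rewrite !o.
Qed.

Section Poly.
Variables (b1 b : nat).
Hypothesis b1b : (b1 <= b)%N.

Definition extend_mon (u : mon V1 b1) : mon V b := [ffun k => inord (extend_exp (fun a => u a) k)].

Lemma extend_monE u k : extend_mon u k = extend_exp (fun a => u a) k :> nat.
Proof.
rewrite ffunE inordK // ltnS /extend_exp; case: pinv => // a.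
by apply: leq_trans b1b; rewrite -ltnS.
Qed.

(** The retraction of polynomial rings that sets the variables outside the image to 0. *)
Definition restrict_poly (p : poly_space K V b) : poly_space K V1 b1 :=
  [ffun u : mon V1 b1 => p (extend_mon u)].

Lemma restrict_polyD p q : restrict_poly (p + q) = restrict_poly p + restrict_poly q.
Proof. by apply/ffunP => u; rewrite !ffunE. Qed.
Lemma restrict_polyZ x p : restrict_poly (x *: p) = x *: restrict_poly p.
Proof. by apply/ffunP => u; rewrite !ffunE. Qed.
Lemma restrict_poly0 : restrict_poly 0 = 0.
Proof. by apply/ffunP => u; rewrite !ffunE. Qed.

Lemma restrict_monom_outside e k : outside k -> e k != 0%N -> restrict_poly (monom K b e) = 0.
Proof.
move=> ok nz; apply/ffunP => u; rewrite [RHS]ffunE ffunE monomE; case: forallP => // /(_ k).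
by rewrite extend_monE extend_exp_outside // eq_sym (negbTE nz).
Qed.

Lemma restrict_monom e : (forall k, outside k -> e k = 0%N) ->
  restrict_poly (monom K b e) = monom K b1 (fun a => e (vmap a)).
Proof.
move=> h; apply/ffunP => u; rewrite ffunE !monomE; congr (_%:R); congr (nat_of_bool _).
apply/forallP/forallP => hu x; first by have := hu (vmap x); rewrite extend_monE extend_exp_vmap.
rewrite extend_monE; case: (boolP (outside x)) => [ox|]; first by rewrite extend_exp_outside ?h.
by rewrite /outside /extend_exp; case E: (pinv x) => [y|] //= _; rewrite (pinvP E); apply: hu.
Qed.

Lemma outside_orP (i : 'I_n) : (forall t, outside (i, t)) \/ exists i', i = f i'.
Proof.
case: (pickP [pred i' | f i' == i]) => [i' /eqP <-|no]; [by right; exists i'|left => t].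
rewrite /outside; case E: (pinv (i, t)) => [x|] //=; have [e _] := pinvP E.
by have := no x.1; rewrite /= e eqxx.
Qed.

(** Both monomials of a minor contain a variable over each endpoint, so a minor with an endpoint
    outside the image is sent to 0, and the others to minors of [g1]. *)
Lemma restrict_poly_Jdeg d p : (d <= b1)%N -> p \in Jdeg K b (bei_gens g) d ->
  restrict_poly p \in Jdeg K b1 (bei_gens g1) d.
Proof.
move=> db; move: p; apply: Jdeg_ind => [|x m y q /bei_gensP [i [j [gij ij ->]]] md IH].
  by rewrite restrict_poly0 mem0v.
rewrite restrict_polyD restrict_polyZ rpredD // rpredZ // /gen_mul -[- monom _ _ _]scaleN1r restrict_polyD restrict_polyZ scaleN1r.
have nze v1 v2 k : [|| m k != 0%N, k == v1 | k == v2] -> exp_add2 m v1 v2 k != 0%N.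
  by rewrite /exp_add2; case: (k == v1); case: (k == v2); lia.
case: (pickP [pred k | outside k && (m k != 0%N)]) => [k /= /andP[ok mon_of]|no].
  by rewrite !(restrict_monom_outside ok) ?subrr ?mem0v // nze // mon_of.
have [oi|[i' ei]] := outside_orP i.
  rewrite (restrict_monom_outside (oi false)) ?(restrict_monom_outside (oi true)) ?subrr ?mem0v //;
    by rewrite nze ?eqxx ?orbT.
have [oj|[j' ej]] := outside_orP j.
  rewrite (restrict_monom_outside (oj true)) ?(restrict_monom_outside (oj false)) ?subrr ?mem0v //;
    by rewrite nze ?eqxx ?orbT.
rewrite {}ei {}ej fg fmono in gij ij *.
have zoff a c k : outside k -> exp_add2 m (vmap a) (vmap c) k = 0%N.
  move=> ok; have := no k; rewrite /= ok /= => /negbFE /eqP mon_of.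
  have o x' : (k == vmap x') = false by apply/eqP => e'; move: ok; rewrite e' outside_vmap.
  by rewrite /exp_add2 !o mon_of.
have -> : edge_gen (f i') (f j') = ((vmap (i', false), vmap (j', true)),
  (vmap (j', false), vmap (i', true))) by [].
rewrite !restrict_monom; try exact: zoff.
have -> : monom K b1 (fun a => exp_add2 m (vmap (i', false)) (vmap (j', true)) (vmap a))
  - monom K b1 (fun a => exp_add2 m (vmap (j', false)) (vmap (i', true)) (vmap a)) =
  gen_mul K b1 (fun a => m (vmap a)) (edge_gen i' j').
  by congr (_ - _); apply: eq_monom => a; rewrite /exp_add2 !(inj_eq vmap_inj).
apply: gen_mul_mem => //; first by apply/bei_gensP; exists i', j'.
rewrite -md; congr (_ + 2)%N; rewrite /deg.
rewrite [RHS](bigID (mem (codom vmap))) /= [X in _ = (_ + X)%N]big1 ?addn0; last first.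
  move=> k /negbTE ck; have := no k; rewrite /= /outside; case E: (pinv k) => [x'|] /=.
    by move: ck; rewrite (pinvP E) codom_f.
  by move/negbFE/eqP.
rewrite -[LHS](big_map vmap xpredT (fun k => m k)) -big_uniq /=; last first.
  by rewrite map_inj_uniq ?enum_uniq //; exact: vmap_inj.
by rewrite /codom /image_mem -[index_enum _]enumT.
Qed.

Definition extend_poly (p : poly_space K V1 b1) : poly_space K V b :=
  \sum_u p u *: monom K b (extend_exp (fun a => u a)).

Lemma extend_polyP x p q : extend_poly (x *: p + q) = x *: extend_poly p + extend_poly q.
Proof.
rewrite /extend_poly scaler_sumr -big_split; apply: eq_bigr => u _ /=.
by rewrite !ffunE scalerDl scalerA.
Qed.

Lemma extend_monom e : (deg e <= b1)%N -> extend_poly (monom K b1 e) = monom K b (extend_exp e).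
Proof.
move=> eb; rewrite /extend_poly (bigD1 (mon_of b1 e)) //= monomE (introT forallP); last first.
  by move=> a; rewrite mon_ofE.
rewrite scale1r big1 ?addr0.
  by apply: eq_monom => k; rewrite /extend_exp; case: pinv => // a; rewrite mon_ofE.
move=> u /eqP um; rewrite monomE; case: forallP => [h|]; last by rewrite scale0r.
by case: um; apply/ffunP => a; apply: val_inj; rewrite /= mon_ofE //; apply/eqP/h.
Qed.

Lemma extend_poly0 : extend_poly 0 = 0.
Proof. by rewrite /extend_poly big1 // => u _; rewrite ffunE scale0r. Qed.

Lemma deg_extend_exp e : deg (extend_exp e) = deg e.
Proof.
rewrite /deg [LHS](bigID (mem (codom vmap))) /= [X in (_ + X)%N]big1 ?addn0; last first.
  move=> k /negbTE ck; apply: extend_exp_outside; rewrite /outside; case E: (pinv k) => [x'|] //.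
  by move: ck; rewrite (pinvP E) codom_f.
rewrite -big_uniq /=; last by rewrite map_inj_uniq ?enum_uniq //; exact: vmap_inj.
rewrite /codom /image_mem big_map big_enum /=.
by apply: eq_bigr => a _; rewrite extend_exp_vmap.
Qed.

Lemma extend_poly_Jdeg d p : (d <= b1)%N -> p \in Jdeg K b1 (bei_gens g1) d ->
  extend_poly p \in Jdeg K b (bei_gens g) d.
Proof.
move=> db; move: p; apply: Jdeg_ind => [|x m y q /bei_gensP [i [j [gij ij ->]]] md IH].
  by rewrite extend_poly0 mem0v.
rewrite extend_polyP rpredD // rpredZ // /gen_mul addrC -scaleN1r extend_polyP scaleN1r addrC.
rewrite !extend_monom ?deg_exp_add2 ?md // !(eq_monom K b (extend_exp_add2 _ _ _)).
have -> : monom K b (exp_add2 (extend_exp m) (vmap (edge_gen i j).1.1) (vmap (edge_gen i j).1.2))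
  - monom K b (exp_add2 (extend_exp m) (vmap (edge_gen i j).2.1) (vmap (edge_gen i j).2.2)) =
  gen_mul K b (extend_exp m) (edge_gen (f i) (f j)) by [].
apply: gen_mul_mem; first by apply/bei_gensP; exists (f i), (f j); rewrite fg fmono.
  by rewrite deg_extend_exp.
exact: leq_trans b1b.
Qed.

Lemma restrict_poly_sum (T : finType) (h : T -> poly_space K V b) :
  restrict_poly (\sum_t h t) = \sum_t restrict_poly (h t).
Proof. exact: (big_morph restrict_poly restrict_polyD restrict_poly0). Qed.

Lemma extend_polyK p : restrict_poly (extend_poly p) = p.
Proof.
rewrite /extend_poly restrict_poly_sum [RHS]monom_sum; apply: eq_bigr => u _;
  rewrite restrict_polyZ restrict_monom.
  by congr (_ *: _); apply: eq_monom => a; rewrite extend_exp_vmap.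
exact: extend_exp_outside.
Qed.

Lemma extend_poly_outside p w k : extend_poly p w != 0 -> outside k -> w k = 0%N :> nat.
Proof.
move=> nz ok; move: nz; rewrite /extend_poly sum_ffunE => nz.
apply/eqP; case: eqVneq => // wk; case/eqP: nz; apply: big1 => u _.
rewrite ffunE monomE; case: forallP => [/(_ k)|]; last by rewrite scaler0.
by rewrite extend_exp_outside // (negbTE wk).
Qed.

Definition disj_image B := forall a, vmap a \notin B.
(* The sign that makes restriction to the sets meeting the complement of the image in [B]
   commute with the differentials. *)
Definition up_sign B A : K := \prod_(a in A) ksign K (vmap a) B.
Definition up_set B A : {set V} := vmap @: A :|: B.

Lemma up_signK B A x : up_sign B A * (up_sign B A * x) = x.
Proof.
rewrite mulrA /up_sign -big_split /= big1 ?mul1r // => a _.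
by rewrite -expr2 sqrr_sign.
Qed.

Lemma up_set_inj B B' A A' : disj_image B -> disj_image B' -> up_set B A = up_set B' A' ->
  A = A' /\ B = B'.
Proof.
move=> oB oB' /setP E; split; apply/setP => x.
  have := E (vmap x); rewrite !inE !(mem_imset _ _ vmap_inj).
  by rewrite (negbTE (oB x)) (negbTE (oB' x)) !orbF.
have := E x; rewrite !inE; case: (boolP (x \in vmap @: A)) => [/imsetP [a _ ->]|_].
  by rewrite (negbTE (oB a)) (negbTE (oB' a)).
case: (boolP (x \in vmap @: A')) => [/imsetP [a _ ->]|_ //].
by rewrite (negbTE (oB a)) (negbTE (oB' a)).
Qed.

Lemma disjoint_up_set B A : disj_image B -> [disjoint vmap @: A & B].
Proof.
move=> oB; apply/pred0P => x /=; apply/negbTE/negP => /andP[/imsetP [a _ ->]].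
by apply/negP.
Qed.

Lemma card_up_set B A : disj_image B -> #|up_set B A| = (#|A| + #|B|)%N.
Proof.
move=> oB; have := disjoint_up_set A oB; rewrite -setI_eq0 => /eqP e.
by rewrite /up_set cardsU e cards0 subn0 card_imset //; apply: vmap_inj.
Qed.

Lemma ksign_up_set B A a : disj_image B -> a \notin A ->
  ksign K (vmap a) (up_set B A) = ksign K a A * ksign K (vmap a) B.
Proof.
move=> oB aA; rewrite /ksign -exprD; congr (_ ^+ _).
have -> : [set x in up_set B A | (enum_rank x < enum_rank (vmap a))%N] =
   vmap @: [set x in A | (enum_rank x < enum_rank a)%N]
   :|: [set x in B | (enum_rank x < enum_rank (vmap a))%N].
  apply/setP => x; rewrite !inE andb_orl; congr (_ || _).
  apply/andP/imsetP => [[/imsetP [y yA ->]]|[y]].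
    by rewrite rank_vmap => h; exists y; rewrite // inE yA.
  by rewrite inE => /andP[yA h] ->; rewrite rank_vmap h (imset_f vmap yA).
rewrite cardsU (_ : _ :&: _ = set0) ?cards0 ?subn0.
  by rewrite card_imset //; apply: vmap_inj.
apply/setP => x; rewrite !inE; apply/negbTE/negP.
by move=> /andP[/imsetP [y _ ->] /andP[yB _]]; move: (oB y); rewrite yB.
Qed.

Lemma up_signU B A a : a \notin A -> up_sign B (a |: A) = ksign K (vmap a) B * up_sign B A.
Proof. by move=> aA; rewrite /up_sign big_setU1. Qed.

Definition restrict_chain B (phi : kspace K V b) : kspace K V1 b1 :=
  [ffun p : {set V1} * mon V1 b1 => up_sign B p.1 * phi (up_set B p.1, extend_mon p.2)].

Lemma slice_restrict_chain B phi A :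
  slice A (restrict_chain B phi) = up_sign B A *: restrict_poly (slice (up_set B A) phi).
Proof. by apply/ffunP => u; rewrite !ffunE. Qed.

Lemma extend_mon_mshift u a : extend_mon (mshift u a) = mshift (extend_mon u) (vmap a).
Proof.
apply/ffunP => k; apply: val_inj; rewrite /= mshiftE !extend_monE /extend_exp.
case E: (pinv k) => [x|] //; rewrite mshiftE (pinvP E).
by rewrite (inj_eq vmap_inj).
Qed.

(** A coefficient of [kdiff phi] at a monomial free of outside variables involves only divisions by
    variables of the image, so the outside part [B] of the set stays fixed. *)
Lemma restrict_chain_kdiff B phi : disj_image B ->
  restrict_chain B (kdiff K V b phi) = kdiff K V1 b1 (restrict_chain B phi).
Proof.
move=> oB; apply/ffunP => -[A u]; rewrite ffunE !kdiffE /= mulr_sumr.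
rewrite (eq_bigl (mem (vmap @: [set a | (a \notin A) && (0 < u a)%N]))); last first.
  move=> k /=; apply/andP/imsetP => [[kA uk]|[a + ->]].
    move: uk; rewrite extend_monE /extend_exp; case E: (pinv k) => [a|] // ua; exists a;
      last exact: pinvP.
    rewrite inE ua andbT; apply: contra kA => aA.
    by rewrite (pinvP E) /up_set inE imset_f.
  rewrite inE => /andP[aA ua]; rewrite extend_monE extend_exp_vmap; split=> //.
  by rewrite /up_set inE (mem_imset _ _ vmap_inj) negb_or aA oB.
rewrite big_imset /=; last by move=> ? ? _ _; apply: vmap_inj.
apply: eq_big => [a|a]; first by rewrite inE.
rewrite inE => /andP[aA ua]; rewrite ffunE /= up_signU // extend_mon_mshift.
have -> : up_set B (a |: A) = vmap a |: up_set B A by rewrite /up_set imsetU1 setUA.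
by rewrite ksign_up_set //; ring.
Qed.

Lemma restrict_chain_Zsp B i d phi : disj_image B -> (d <= b1)%N ->
  phi \in Zsp K b (bei_gens g) (i + #|B|) d -> restrict_chain B phi \in Zsp K b1 (bei_gens g1) i d.
Proof.
move=> oB db /Zsp_P h; apply/Zsp_P => A; have [h1 h2] := h (up_set B A).
rewrite slice_restrict_chain; split; first by rewrite rpredZ // restrict_poly_Jdeg.
by move=> Ai; rewrite h2 ?restrict_poly0 ?scaler0 // card_up_set // eqn_add2r.
Qed.

Lemma restrict_chain_eq0 B i d phi : disj_image B -> (i < #|B|)%N -> homog i d phi ->
  restrict_chain B phi = 0.
Proof.
move=> oB iB h; apply/ffunP => -[A u]; rewrite !ffunE /=.
case: (eqVneq (phi (up_set B A, extend_mon u)) 0) => [->|/h [e _]]; first by rewrite mulr0.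
by move: iB; rewrite -e card_up_set // ltnNge leq_addl.
Qed.

(** A right inverse of [restrict_chain B]. For non-empty [B] the differential of an extended chain
    can also have components on sets with an element of [B] removed, so commutation is available
    only after restriction. *)
Definition extend_chain B (chi : kspace K V1 b1) : kspace K V b :=
  \sum_A tens (up_set B A) (up_sign B A *: extend_poly (slice A chi)).

Lemma slice_sum (T : finType) (A' : {set V}) (h : T -> kspace K V b) :
  slice A' (\sum_t h t) = \sum_t slice A' (h t).
Proof. by apply: (big_morph (slice A')); [apply: sliceD | apply: slice0]. Qed.

Lemma slice_extend_chain B chi A : disj_image B ->
  slice (up_set B A) (extend_chain B chi) = up_sign B A *: extend_poly (slice A chi).
Proof.
move=> oB; rewrite /extend_chain slice_sum (bigD1 A) //= slice_tens eqxx big1 ?addr0 // => A' AA.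
rewrite slice_tens; case: eqP => // /(up_set_inj oB oB) [e _].
by rewrite e eqxx in AA.
Qed.

Lemma slice_extend_chain0 B chi (A' : {set V}) : (forall A, A' != up_set B A) ->
  slice A' (extend_chain B chi) = 0.
Proof.
by move=> h; rewrite /extend_chain slice_sum big1 // => A _; rewrite slice_tens (negbTE (h A)).
Qed.

Lemma extend_chainK B chi : disj_image B -> restrict_chain B (extend_chain B chi) = chi.
Proof.
move=> oB; apply/ffunP => -[A u]; rewrite -[LHS]/((restrict_chain B (extend_chain B chi)) (A, u)).
have := slice_restrict_chain B (extend_chain B chi) A;
  rewrite slice_extend_chain // restrict_polyZ extend_polyK => /ffunP/(_ u).
by rewrite !ffunE => ->; rewrite [LHS]up_signK.
Qed.

Lemma extend_chain_Zsp B i d chi : disj_image B -> (d <= b1)%N ->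
  chi \in Zsp K b1 (bei_gens g1) i d -> extend_chain B chi \in Zsp K b (bei_gens g) (i + #|B|) d.
Proof.
move=> oB db /Zsp_P h; apply: rpred_sum => A _; have [h1 h2] := h A.
apply/Zsp_P => A'; rewrite slice_tens; case: eqP => [->|_]; last by rewrite mem0v.
split; first by rewrite rpredZ // extend_poly_Jdeg.
by rewrite card_up_set // eqn_add2r => /h2 ->; rewrite extend_poly0 scaler0.
Qed.

Lemma extend_chain_outside B chi (A' : {set V}) w k : disj_image B ->
  extend_chain B chi (A', w) != 0 -> outside k -> w k = 0%N :> nat.
Proof.
move=> oB nz ok; have : slice A' (extend_chain B chi) w != 0 by rewrite ffunE.
case: (pickP [pred A | A' == up_set B A]) => [A /eqP ->|no]; last first.
  by rewrite slice_extend_chain0 ?ffunE ?eqxx // => A; have := no A; rewrite /= => ->.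
rewrite slice_extend_chain // ffunE => nz'; apply: (@extend_poly_outside (slice A chi)) ok.
by apply: contraNneq nz' => ->; rewrite scaler0.
Qed.

End Poly.

End Transfer.

(** [kspace] depends on the truncation bound, and after restriction the bound [b - #|B|] equals
    [i + d] only propositionally. *)
Lemma exactK_at (K : fieldType) (W : finType) (gens : seq ((W * W) * (W * W))) i d b
  (phi : kspace K W b) :
  exactK K gens i d -> b = (i + d)%N -> phi \in Zsp K b gens i d -> kdiff K W b phi = 0%R ->
  exists2 psi : kspace K W b, psi \in Zsp K b gens i.+1 d.-1 & kdiff K W b psi = phi.
Proof. by move=> ex e; move: phi; rewrite e; apply: ex. Qed.

(** * Comparison with the complete graph *)

Section Monotone.
Local Open Scope ring_scope.
Variables (K : fieldType) (n : nat).
Notation V := ('I_n * bool)%type.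
Implicit Types (g : rel 'I_n) (i j v : 'I_n).

Lemma Jdeg_complete b d g : (d <= b)%N ->
  (Jdeg K b (bei_gens g) d <= Jdeg K b (bei_gens (@complete_rel n)) d)%VS.
Proof.
move=> db; apply/subvP; apply: Jdeg_ind => [|a e x y /bei_gensP [i [j [_ ij ->]]] ed IH].
  exact: mem0v.
rewrite rpredD // rpredZ // gen_mul_mem //; apply/bei_gensP; exists i, j.
by split=> //; rewrite /complete_rel neq_ltn ij.
Qed.

Lemma Zsp_complete b (i d : nat) g phi : (d <= b)%N -> phi \in Zsp K b (bei_gens g) i d ->
  phi \in Zsp K b (bei_gens (@complete_rel n)) i d.
Proof.
move=> db /Zsp_P h; apply/Zsp_P => A; have [h1 h2] := h A; split=> //.
exact: (subvP (Jdeg_complete g db)).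
Qed.

(* [x_v x_i y_j - x_v x_j y_i = x_i (x_v y_j - x_j y_v) + x_j (x_i y_v - x_v y_i)],
   and similarly for [y_v]. *)
Lemma common_neighbour b d g m i j v t : symmetric g -> m (v, t) != 0%N ->
  g i v -> g v j -> i != v -> v != j -> (deg m + 2 = d)%N -> (d <= b)%N ->
  gen_mul K b m (edge_gen i j) \in Jdeg K b (bei_gens g) d.
Proof.
move=> gs mv giv gvj iv vj md db.
have [m' mE] : exists m' : V -> nat, forall k, m k = (m' k + (k == (v, t)))%N.
  exists (fun k => m k - (k == (v, t)))%N => k.
  by rewrite subnK //; case: eqP => [->|//]; rewrite lt0n.
pose m1 k (l : V) := (m' l + (l == k))%N.
have dm1 k : (deg (m1 k) + 2 = d)%N.
  rewrite -md; congr (_ + 2)%N; rewrite /deg (eq_bigr _ (fun l _ => mE l)).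
  by rewrite /m1 !big_split /= !sum_pred1.
have J k i' j' : g i' j' -> i' != j' ->
  gen_mul K b (m1 k) (edge_gen i' j') \in Jdeg K b (bei_gens g) d.
  by move=> gij ne; apply: swapJ.
rewrite (eq_gen_mul K b _ mE) /gen_mul /edge_gen /=.
case: t mv mE => _ _.
  suff -> : monom K b (exp_add2 (fun l => m' l + (l == (v, true)))%N (i, false) (j, true))
    - monom K b (exp_add2 (fun l => m' l + (l == (v, true)))%N (j, false) (i, true)) =
    gen_mul K b (m1 (j, true)) (edge_gen i v) + gen_mul K b (m1 (i, true)) (edge_gen v j).
    by rewrite rpredD ?J.
  rewrite /gen_mul /edge_gen /= (@eq_monom _ _ b (exp_add2 (m1 (i, true)) (v, false) (j, true))
    (exp_add2 (m1 (j, true)) (v, false) (i, true))); last by move=> l; rewrite /exp_add2 /m1; ring.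
  by rewrite addrA subrK; congr (_ - _); apply: eq_monom => l; rewrite /exp_add2 /m1; ring.
suff -> : monom K b (exp_add2 (fun l => m' l + (l == (v, false)))%N (i, false) (j, true))
  - monom K b (exp_add2 (fun l => m' l + (l == (v, false)))%N (j, false) (i, true)) =
  gen_mul K b (m1 (i, false)) (edge_gen v j) + gen_mul K b (m1 (j, false)) (edge_gen i v).
  by rewrite rpredD ?J.
rewrite /gen_mul /edge_gen /= (@eq_monom _ _ b (exp_add2 (m1 (j, false)) (i, false) (v, true))
  (exp_add2 (m1 (i, false)) (j, false) (v, true))); last by move=> l; rewrite /exp_add2 /m1; ring.
by rewrite addrA subrK; congr (_ - _); apply: eq_monom => l; rewrite /exp_add2 /m1; ring.
Qed.

End Monotone.

(** * Cycles and corrections over an induced subgraph *)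

Section Side.
Local Open Scope ring_scope.
Variables (K : fieldType) (n1 n : nat) (f : 'I_n1 -> 'I_n).
Variables (g1 : rel 'I_n1) (g : rel 'I_n).
Hypothesis fmono : forall i j, (f i < f j)%N = (i < j)%N.
Hypothesis fg : forall i j, g (f i) (f j) = g1 i j.
Notation V1 := ('I_n1 * bool)%type.
Notation V := ('I_n * bool)%type.
Implicit Types (A : {set V1}) (B : {set V}).

Lemma complete_rel_map i j : complete_rel (f i) (f j) = complete_rel i j.
Proof. by rewrite /complete_rel (inj_eq (fmono_inj fmono)). Qed.

Lemma restrict_monomK b1 b (e : V -> nat) : (b1 <= b)%N -> (deg e <= b1)%N ->
  (forall k, outside f k -> e k = 0%N) ->
    extend_poly f b (restrict_poly f b1 (monom K b e)) = monom K b e.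
Proof.
move=> b1b eb eo.
have E : extend_exp f (fun a => e (vmap f a)) =1 e.
  move=> k; case: (boolP (outside f k)) => [ok|]; first by rewrite extend_exp_outside ?eo.
  by rewrite /outside /extend_exp; case Ek: (pinv f k) => [a|] //= _; rewrite (pinvP Ek).
rewrite (restrict_monom K fmono b1b eo) extend_monom; first exact: eq_monom.
by rewrite -(deg_extend_exp fmono) /deg (eq_bigr _ (fun k _ => E k)).
Qed.

Lemma restrict_gen_mul_outside b1 b m i j k : (b1 <= b)%N -> outside f k ->
  [|| m k != 0%N, k.1 == i | k.1 == j] -> restrict_poly f b1 (gen_mul K b m (edge_gen i j)) = 0.
Proof.
move=> b1b ok h.
have disj_imageb t : outside f (k.1, t).
  have := ok; rewrite /outside /pinv; case: pickP => // no _; case: pickP => // a /eqP [e1 _].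
  by have := no (a.1, k.2); rewrite /vmap /= e1 -surjective_pairing eqxx.
rewrite /gen_mul /edge_gen /= -[- monom _ _ _]scaleN1r restrict_polyD restrict_polyZ.
suff [[k1 o1 z1] [k2 o2 z2]] :
   (exists2 k1, outside f k1 & exp_add2 m (i, false) (j, true) k1 != 0%N) /\
   (exists2 k1, outside f k1 & exp_add2 m (j, false) (i, true) k1 != 0%N).
  by rewrite (restrict_monom_outside K b1b o1 z1) (restrict_monom_outside K b1b o2 z2) scaler0 addr0.
case/or3P: h => [mon_of|/eqP <-|/eqP <-].
- by split; exists k => //; rewrite /exp_add2; move: mon_of; case: (m k).
- split; [exists (k.1, false)|exists (k.1, true)] => //; rewrite /exp_add2 eqxx; lia.
- split; [exists (k.1, true)|exists (k.1, false)] => //; rewrite /exp_add2 eqxx; lia.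
Qed.

(** With [B] empty, a cycle of the subgraph extends to a cycle of the larger graph; a bound of it
    there restricts to a bound of the original cycle. *)
Lemma induced_exact i d : exactK K (bei_gens g) i d -> exactK K (bei_gens g1) i d.
Proof.
move=> ex phi pZ pD; set b := (i + d)%N in phi pZ pD *.
have o0 : disj_image f set0 by move=> a; rewrite inE.
have db : (d <= b)%N by rewrite leq_addl.
have eZ : extend_chain f b set0 phi \in Zsp K b (bei_gens g) i d.
  by have := extend_chain_Zsp fmono fg (leqnn b) o0 db pZ; rewrite cards0 addn0.
have [|psi hpsi psiD] := ex _ eZ.
  (* A non-zero coefficient of the differential comes from a set in the image and a monomial free of
     outside variables. Its own set and monomial then lie in the image, so restriction detects it,
     although the restricted differential is [kdiff phi = 0]. *)
  apply/ffunP => -[A' w]; rewrite [RHS]ffunE; apply/eqP; case: eqVneq => // nz.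
  have [k [kA wk nk]] : exists k, [/\ k \notin A', (0 < w k)%N
      & extend_chain f b set0 phi (k |: A', mshift w k) != 0].
    move: nz; rewrite kdiffE /= => nz.
    case: (pickP [pred k | [&& k \notin A', (0 < w k)%N
      & extend_chain f b set0 phi (k |: A', mshift w k) != 0]]) => [k /and3P[*]|no];
        first by exists k.
    move/eqP: nz; case; apply: big1 => k /andP[kA wk]; move: (no k).
    by rewrite /= kA wk /= => /negbFE /eqP ->; rewrite mulr0.
  have [A eA] : exists A, k |: A' = up_set f set0 A.
    case: (pickP [pred A | k |: A' == up_set f set0 A]) => [A /eqP|no]; first by exists A.
    have := @slice_extend_chain0 K _ _ f b b set0 phi (k |: A') (fun A => negbT (no A)).
    by move=> /ffunP/(_ (mshift w k)); rewrite !ffunE => e; rewrite e eqxx in nk.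
  have [a ka] : exists a, k = vmap f a.
    by have := setU11 k A'; rewrite eA /up_set setU0 => /imsetP [a _ ->]; exists a.
  have eA' : A' = up_set f set0 (A :\ a).
    apply/setP => x; have /setP/(_ x) := eA; rewrite /up_set !setU0 !inE.
    case: (eqVneq x k) => [-> _|xk /= ->].
      by rewrite (negbTE kA) ka (mem_imset _ _ (vmap_inj fmono)) !inE eqxx.
    apply/imsetP/imsetP => [[y yA e]|[y]].
      by exists y => //; rewrite !inE yA andbT; apply: contraNneq xk => ya; rewrite e ya ka.
    by rewrite !inE => /andP[_ yA] e; exists y.
  have wE : w = extend_mon f b (mon_of b (fun a => w (vmap f a))).
    apply/ffunP => x; apply: val_inj; rewrite /= extend_monE // /extend_exp.
    case E : (pinv f x) => [y|].
      by rewrite ffunE inordK // (pinvP E).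
    have ox : outside f x by rewrite /outside E.
    have := extend_chain_outside fmono o0 nk ox; rewrite mshiftE.
    by case: eqP => [e|_]; [move: ox; rewrite e ka outside_vmap | rewrite subn0].
  have := restrict_chain_kdiff fmono (leqnn b) (extend_chain f b set0 phi) o0;
    rewrite extend_chainK // pD.
  move=> /ffunP/(_ (A :\ a, mon_of b (fun a => w (vmap f a))));
    rewrite [RHS]ffunE ffunE /= -wE -eA'.
  move/(congr1 (fun x => up_sign K f set0 (A :\ a) * x)); rewrite up_signK mulr0 => e.
  by rewrite e eqxx in nz.
exists (restrict_chain f b set0 psi).
  apply: (restrict_chain_Zsp fmono fg (leqnn b) o0); last by rewrite cards0 addn0.
  exact: leq_trans (leq_pred d) db.
by rewrite -(restrict_chain_kdiff fmono (leqnn b) _ o0) psiD extend_chainK.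
Qed.

(* The restriction of [w] and a bound of the cycle [kdiff w] over the smaller ideal differ by a
   cycle of the complete graph, hence by a boundary. *)
Lemma one_side_correction i d (w : kspace K V (i + d)) B :
  (4 <= d)%N -> (forall i', exactK K (bei_gens g1) i' d) -> disj_image f B ->
  w \in Zsp K (i + d) (bei_gens (@complete_rel n)) i.+1 d.-1 ->
  kdiff K V (i + d) w \in Zsp K (i + d) (bei_gens g) i d ->
  exists v, [/\ v \in Zsp K (i + d) (bei_gens (@complete_rel n)) i.+2 d.-2,
    forall A' : {set V}, (forall A, A' != up_set f B A) -> slice A' v = 0,
    forall (A' : {set V}) u k, v (A', u) != 0 -> outside f k -> u k = 0%N :> nat &
    forall A, slice A (restrict_chain f (i + d - #|B|) B (w - kdiff K V (i + d) v))
      \in Jdeg K (i + d - #|B|) (bei_gens g1) d.-1].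
Proof.
move=> d4 ex1 oB wZ zZ; set b := (i + d)%N in w wZ zZ *; set b1 := (b - #|B|)%N.
have b1b : (b1 <= b)%N by apply: leq_subr.
have zD : kdiff K V b (kdiff K V b w) = 0.
  by apply: (kdiff_kdiff (Zsp_homog wZ)); rewrite /b; lia.
(* Sets containing [B] may be too large for [w]; its strand over [B] is then 0 and needs no
   correction. *)
have [Bi|iB] := leqP #|B| i.+1; last first.
  exists 0; split.
  - exact: mem0v.
  - by move=> *; rewrite slice0.
  - by move=> A' u k; rewrite ffunE eqxx.
  - move=> A; rewrite linear0 subr0 (restrict_chain_eq0 fmono b1 oB iB (Zsp_homog wZ)).
    by rewrite slice0 mem0v.
pose i' := (i.+1 - #|B|)%N.
have iE : (i' + #|B|)%N = i.+1 by rewrite subnK.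
have bE : b1 = (i' + d.-1)%N by rewrite /b1 /i' /b; lia.
have [u uZ uD] : exists2 u, u \in Zsp K b1 (bei_gens g1) i' d.-1
    & kdiff K V1 b1 u = restrict_chain f b1 B (kdiff K V b w).
  (* For [#|B| = i.+1] the strand of [kdiff w] over [B] is already 0, and so [u = 0] serves. *)
  have [Bi'|iB] := leqP #|B| i; last first.
    exists 0; first exact: mem0v.
    by rewrite linear0 (restrict_chain_eq0 fmono b1 oB iB (Zsp_homog zZ)).
  have i'E : i' = (i - #|B|).+1 by rewrite /i' subSn.
  have [|||u uZ uD] := @exactK_at K _ (bei_gens g1) (i - #|B|) d b1 (restrict_chain f b1 B (kdiff K V b w)) (ex1 _).
  - by rewrite bE i'E; lia.
  - by apply: (restrict_chain_Zsp fmono fg b1b oB); rewrite ?subnK // bE i'E; lia.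
  - rewrite -(restrict_chain_kdiff fmono b1b _ oB) zD; apply/ffunP => p; rewrite !ffunE mulr0 //.
  - by exists u; rewrite // i'E.
(* The linear resolution is used in degree [d.-1], which is why [4 <= d] is required. *)
have [||||v' vZ vD] := @exactK_at K _ _ i' d.-1 b1 (restrict_chain f b1 B w - u) (@complete_exact K n1 i' d.-1 _).
- by lia.
- exact: bE.
- rewrite rpredB //; last by apply: (Zsp_complete _ uZ); rewrite bE leq_addl.
  by apply: (restrict_chain_Zsp fmono complete_rel_map b1b oB); rewrite ?iE // bE leq_addl.
- by rewrite linearB /= uD -(restrict_chain_kdiff fmono b1b _ oB) subrr.
have dd : (d.-2 <= b1)%N by rewrite bE; lia.
exists (extend_chain f b B v'); split.
- by have := extend_chain_Zsp fmono complete_rel_map b1b oB dd vZ; rewrite addSn iE.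
- by move=> A' h; apply: slice_extend_chain0.
- by move=> A' x k; apply: extend_chain_outside.
- move=> A; rewrite (_ : restrict_chain _ _ _ _ = u); first by have /Zsp_P/(_ A) [] := uZ.
  have restrict_chainB p q : restrict_chain f b1 B (p - q) = restrict_chain f b1 B p - restrict_chain f b1 B q :> kspace K V1 b1.
    by apply/ffunP => x; rewrite !ffunE mulrBr.
  by rewrite restrict_chainB (restrict_chain_kdiff fmono b1b _ oB) extend_chainK // vD opprB addrC subrK.
Qed.

End Side.

Lemma addrB2ACA (U : zmodType) (a b c d e g : U) :
  (a + b - (c + d) - (e + g) = (a - c - e) + (b - d - g))%R.
Proof. by rewrite !opprD (addrACA a) [LHS]addrACA. Qed.

Section Side2.
Local Open Scope ring_scope.
Variables (K : fieldType) (n1 n1' n : nat) (f : 'I_n1 -> 'I_n) (f' : 'I_n1' -> 'I_n).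
Hypothesis fmono : forall i j, (f i < f j)%N = (i < j)%N.
Notation V := ('I_n * bool)%type.
Implicit Types (B : {set V}).

Lemma restrict_gen_mulK b1 b m i j : (b1 <= b)%N -> (deg m + 2 <= b1)%N ->
  (forall k, outside f k -> m k = 0%N) ->
  extend_poly f b (restrict_poly f b1 (gen_mul K b m (edge_gen (f i) (f j)))) = gen_mul K b m (edge_gen (f i) (f j)).
Proof.
move=> b1b md mo.
have eo a c k : outside f k -> exp_add2 m (vmap f a) (vmap f c) k = 0%N.
  move=> ok; have o x : (k == vmap f x) = false by apply/eqP => e; rewrite e outside_vmap in ok.
  by rewrite /exp_add2 !o mo.
have -> : gen_mul K b m (edge_gen (f i) (f j)) = (-1) *: monom K b (exp_add2 m (vmap f (j, false)) (vmap f (i, true)))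
    + monom K b (exp_add2 m (vmap f (i, false)) (vmap f (j, true))).
  by rewrite scaleN1r addrC.
by rewrite restrict_polyD restrict_polyZ extend_polyP !(restrict_monomK K fmono b1b) ?deg_exp_add2 //; apply: eo.
Qed.

Lemma restrict_chain_vanish b1 b B (X : kspace K V b) :
  (forall A (u : mon _ b1), X (up_set f B A, extend_mon f b u) = 0) ->
  restrict_chain f b1 B X = 0.
Proof. by move=> h; apply/ffunP => -[A u]; rewrite !ffunE /= h mulr0. Qed.

Lemma restrict_chainB b1 b B (p q : kspace K V b) :
  restrict_chain f b1 B (p - q) = restrict_chain f b1 B p - restrict_chain f b1 B q.
Proof. by apply/ffunP => x; rewrite !ffunE mulrBr. Qed.

Lemma restrict_chainD b1 b B (p q : kspace K V b) :
  restrict_chain f b1 B (p + q) = restrict_chain f b1 B p + restrict_chain f b1 B q.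
Proof. by apply/ffunP => x; rewrite !ffunE mulrDr. Qed.

(** Over [B] only the correction [VL B] is visible: the other [VL B'] live on sets with a different
    outside part, and the [VR B'] have monomials of positive degree in the variables of the other
    factor, which restriction kills. *)
Lemma restrict_chain_fix b1 b i d B (w : kspace K V b) (VL VR : {set V} -> kspace K V b) (PL PR :
  pred {set V}) :
  (b1 <= b)%N -> (0 < d)%N -> (forall k, outside f k || outside f' k) ->
  (forall B, PL B -> disj_image f B) -> PL B ->
  (forall B, PL B -> forall A' : {set V}, (forall A, A' != up_set f B A) -> slice A' (VL B) = 0) ->
  (forall B, PR B -> homog i d (VR B) /\
     forall (A' : {set V}) u k, VR B (A', u) != 0 -> outside f' k -> u k = 0%N :> nat) ->
  restrict_chain f b1 B (w - kdiff K V b (\sum_(B | PL B) VL B + \sum_(B | PR B) VR B)) =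
  restrict_chain f b1 B (w - kdiff K V b (VL B)).
Proof.
move=> b1b d0 offs offL PB hL hR; have oB := offL _ PB.
rewrite (bigD1 B) //= -addrA; set Y := (_ + \sum_(B | PR B) VR B).
suff Y0 : restrict_chain f b1 B Y = 0.
  by rewrite linearD opprD addrA [LHS]restrict_chainB (restrict_chain_kdiff fmono b1b _ oB) Y0 linear0 subr0.
rewrite /Y restrict_chainD [X in X + _]restrict_chain_vanish ?[X in _ + X]restrict_chain_vanish ?addr0 //= => A u.
  rewrite sum_ffunE; apply: big1 => B' PB'; have [hh ho] := hR _ PB'.
  apply/eqP; case: eqVneq => // nz.
  have [_ md] := hh _ _ nz; move: d0; rewrite -md /mdeg big1 // => k _.
  case/orP: (offs k) => ok; last exact: ho nz ok.
  by rewrite extend_monE // extend_exp_outside.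
rewrite sum_ffunE; apply: big1 => B' /andP[PB' BB].
have e0 : slice (up_set f B A) (VL B') = 0.
  apply: (hL _ PB') => A1; apply/eqP => /(up_set_inj fmono oB (offL _ PB')) [_ e].
  by rewrite e eqxx in BB.
by move/ffunP/(_ (extend_mon f b u)): e0; rewrite !ffunE.
Qed.

Definition disj_imageb B := [forall a, vmap f a \notin B].
Lemma disj_imageP B : reflect (disj_image f B) (disj_imageb B). Proof. exact: forallP. Qed.

Lemma up_set_split (A' : {set V}) :
  exists A B, [/\ disj_image f B, A' = up_set f B A & B \subset A'].
Proof.
exists [set a | vmap f a \in A'], (A' :\: [set vmap f a | a in setT]); split.
- by move=> a; rewrite !inE imset_f.
- apply/setP => x; rewrite !inE.
  have -> : (x \in vmap f @: [set a | vmap f a \in A']) = (x \in vmap f @: setT) && (x \in A').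
    apply/imsetP/andP => [[a + ->]|[/imsetP [a _ ->] h]].
      by rewrite inE imset_f.
    by exists a; rewrite ?inE.
  by case: (x \in vmap f @: setT); case: (x \in A').
- exact: subsetDl.
Qed.

End Side2.

(** * Joins *)

Section Join.
Local Open Scope ring_scope.
Variables (K : fieldType) (n1 n2 : nat) (e1 : rel 'I_n1) (e2 : rel 'I_n2).
Hypotheses (s1 : symmetric e1) (s2 : symmetric e2).
Notation G := (join_graph e1 e2).
Notation L := (@lshift n1 n2).
Notation R := (@rshift n1 n2).
Notation V := ('I_(n1 + n2) * bool)%type.

Lemma lshift_mono i j : (L i < L j)%N = (i < j)%N. Proof. by []. Qed.
Lemma rshift_mono i j : (R i < R j)%N = (i < j)%N. Proof. exact: ltn_add2l. Qed.

Lemma split_l i : split (L i) = inl i. Proof. exact: (unsplitK (inl i)). Qed.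
Lemma split_r i : split (R i) = inr i. Proof. exact: (unsplitK (inr i)). Qed.

Lemma join_ll i j : G (L i) (L j) = e1 i j. Proof. by rewrite /join_graph !split_l. Qed.
Lemma join_rr i j : G (R i) (R j) = e2 i j. Proof. by rewrite /join_graph !split_r. Qed.
Lemma join_lr i j : G (L i) (R j). Proof. by rewrite /join_graph split_l split_r. Qed.
Lemma join_rl i j : G (R i) (L j). Proof. by rewrite /join_graph split_l split_r. Qed.

Lemma join_sym : symmetric G.
Proof. by move=> x y; rewrite /join_graph; case: (split x); case: (split y). Qed.

Lemma outside_l j t : outside L (R j, t).
Proof. by rewrite /outside; case E: pinv => [a|] //; have /eqP := congr1 fst (pinvP E);
  rewrite /= eq_rlshift. Qed.

Lemma outside_r j t : outside R (L j, t).
Proof. by rewrite /outside; case E: pinv => [a|] //; have /eqP := congr1 fst (pinvP E);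
  rewrite /= eq_lrshift. Qed.

Lemma outside_lr k : outside L k || outside R k.
Proof. by case: k => v t; case: (split_ordP v) => j ->; rewrite ?outside_l ?outside_r ?orbT. Qed.

Lemma outside_lP k : outside L k -> exists j, k.1 = R j.
Proof.
case: k => v t; case: (split_ordP v) => j ->; last by exists j.
by rewrite -[(L j, t)]/(vmap L (j, t)) (outside_vmap lshift_mono).
Qed.

Lemma outside_rP k : outside R k -> exists j, k.1 = L j.
Proof.
case: k => v t; case: (split_ordP v) => j ->; first by exists j.
by rewrite -[(R j, t)]/(vmap R (j, t)) (outside_vmap rshift_mono).
Qed.

(* In mixed bidegrees the ideal of the join is the ideal of the complete graph, and in
   pure bidegrees it is the ideal of one of the two factors. *)
Lemma join_Jdeg b bL bR d p : (bL <= b)%N -> (bR <= b)%N -> (d <= bL)%N -> (d <= bR)%N ->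
  p \in Jdeg K b (bei_gens (@complete_rel (n1 + n2))) d ->
  restrict_poly L bL p \in Jdeg K bL (bei_gens e1) d ->
  restrict_poly R bR p \in Jdeg K bR (bei_gens e2) d ->
  p \in Jdeg K b (bei_gens G) d.
Proof.
move=> bLb bRb dL dR pJ pL pR.
(* Subtracting both pure components is linear in [q], so it suffices to treat multiples of single
   generators. *)
pose T (q : poly_space K V b) : poly_space K V b := q - extend_poly L b (restrict_poly L bL q) - extend_poly R b (restrict_poly R bR q).
suff TJ : T p \in Jdeg K b (bei_gens G) d.
  rewrite (_ : p = T p + extend_poly R b (restrict_poly R bR p) + extend_poly L b (restrict_poly L bL p)); last by rewrite /T !subrK.
  have JR := extend_poly_Jdeg rshift_mono join_rr bRb dR pR.
  have JL := extend_poly_Jdeg lshift_mono join_ll bLb dL pL.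
  exact: rpredD (rpredD TJ JR) JL.
move: p pJ {pL pR}; apply: Jdeg_ind => [|x m y q + md IH].
  by rewrite /T !restrict_poly0 !extend_poly0 !subr0 mem0v.
have -> : T (x *: gen_mul K b m y + q) = x *: T (gen_mul K b m y) + T q.
  move: (gen_mul K b m y) => z.
  by rewrite /T !restrict_polyD !restrict_polyZ !extend_polyP !scalerBr; apply: addrB2ACA.
move=> /bei_gensP [i [j [ij lt ->]]]; rewrite rpredD // rpredZ // /T {IH T q}.
have db : (d <= b)%N by apply: leq_trans bLb.
case: (split_ordP i) ij lt => i' -> ; case: (split_ordP j) => j' -> ij lt.
- rewrite (restrict_gen_mul_outside (k := (L i', false)) K bRb (outside_r _ _)) ?eqxx ?orbT // extend_poly0 subr0.
  (* For two vertices of the first factor, a variable of the second factor in the multiplier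
     supplies a common neighbour; without one the multiple is pure and [T] kills it. *)
  case: (pickP [pred k | outside L k && (m k != 0%N)]) => [k /= /andP[ok mon_of]|no].
    rewrite (restrict_gen_mul_outside K bLb ok) ?mon_of // extend_poly0 subr0.
    have [v kv] := outside_lP ok; rewrite (surjective_pairing k) kv in mon_of.
    by apply: (common_neighbour K join_sym mon_of) => //;
      rewrite ?join_lr ?join_rl ?eq_lrshift ?eq_rlshift.
  rewrite (restrict_gen_mulK K lshift_mono) ?subrr ?mem0v // ?md // => k ok.
  by have := no k; rewrite /= ok /= => /negbFE /eqP.
- rewrite (restrict_gen_mul_outside (k := (L i', false)) K bRb (outside_r _ _)) ?eqxx ?orbT // extend_poly0 subr0.
  rewrite (restrict_gen_mul_outside (k := (R j', false)) K bLb (outside_l _ _)) ?eqxx ?orbT // extend_poly0 subr0.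
  by apply: swapJ => //; [exact: join_sym | exact: join_lr].
- rewrite (restrict_gen_mul_outside (k := (L j', false)) K bRb (outside_r _ _)) ?eqxx ?orbT // extend_poly0 subr0.
  rewrite (restrict_gen_mul_outside (k := (R i', false)) K bLb (outside_l _ _)) ?eqxx ?orbT // extend_poly0 subr0.
  by apply: swapJ => //; [exact: join_sym | exact: join_rl].
- rewrite (restrict_gen_mul_outside (k := (R i', false)) K bLb (outside_l _ _)) ?eqxx ?orbT // extend_poly0 subr0.
  case: (pickP [pred k | outside R k && (m k != 0%N)]) => [k /= /andP[ok mon_of]|no].
    rewrite (restrict_gen_mul_outside K bRb ok) ?mon_of // extend_poly0 subr0.
    have [v kv] := outside_rP ok; rewrite (surjective_pairing k) kv in mon_of.
    by apply: (common_neighbour K join_sym mon_of) => //;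
      rewrite ?join_lr ?join_rl ?eq_lrshift ?eq_rlshift.
  rewrite (restrict_gen_mulK K rshift_mono) ?subrr ?mem0v // ?md // => k ok.
  by have := no k; rewrite /= ok /= => /negbFE /eqP.
Qed.

(** The corrections for all outside parts [B] and both factors are subtracted at once, since they do
    not interact ([restrict_chain_fix]); mixed components need none ([join_Jdeg]). *)
Lemma join_exact d : (4 <= d)%N ->
  (forall i, exactK K (bei_gens e1) i d) -> (forall i, exactK K (bei_gens e2) i d) ->
  forall i, exactK K (bei_gens G) i d.
Proof.
move=> d4 ex1 ex2 i phi pZ pD; set b := (i + d)%N in phi pZ pD *.
have [|||w wZ wD] := @complete_exact K (n1 + n2) i d _ phi.
- by lia.
- exact: (Zsp_complete (leq_addl i d) pZ).
- exact: pD.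
rewrite -/b in w wZ wD.
have zZ : kdiff K V b w \in Zsp K b (bei_gens G) i d by rewrite wD.
(* When [B] meets the image, the requirement is void and 0 is supplied. *)
have [VL hVL] := @choice_on _ _ (fun B v => disj_image L B -> _) (enum {: {set V}}) 0
  (fun B => match disj_imageP L B with
    | ReflectT oB => let: ex_intro v h := one_side_correction lshift_mono join_ll d4 ex1 oB wZ zZ in
                     ex_intro _ v (fun _ => h)
    | ReflectF no => ex_intro _ 0 (fun oB => False_ind _ (no oB)) end).
have [VR hVR] := @choice_on _ _ (fun B v => disj_image R B -> _) (enum {: {set V}}) 0
  (fun B => match disj_imageP R B with
    | ReflectT oB => let: ex_intro v h := one_side_correction rshift_mono join_rr d4 ex2 oB wZ zZ in
                     ex_intro _ v (fun _ => h)
    | ReflectF no => ex_intro _ 0 (fun oB => False_ind _ (no oB)) end).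
have {}hVL B : disj_image L B -> _ := hVL B (mem_enum _ B).
have {}hVR B : disj_image R B -> _ := hVR B (mem_enum _ B).
pose U := \sum_(B | disj_imageb L B) VL B + \sum_(B | disj_imageb R B) VR B.
have UZ : U \in Zsp K b (bei_gens (@complete_rel (n1 + n2))) i.+2 d.-2.
  by rewrite rpredD //; apply: rpred_sum => B /disj_imageP oB;
    [case: (hVL _ oB) | case: (hVR _ oB)].
exists (w - kdiff K V b U); last first.
  by rewrite linearB /= wD (kdiff_kdiff (Zsp_homog UZ)) ?subr0 // /b; lia.
have w'Z : w - kdiff K V b U \in Zsp K b (bei_gens (@complete_rel (n1 + n2))) i.+1 d.-1.
  rewrite rpredB // (_ : d.-1 = d.-2.+1); last by lia.
  by apply: kdiff_Zsp; rewrite // /b; lia.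
have /Zsp_P h := w'Z; apply/Zsp_P => A'; have [h1 h2] := h A'; split=> //.
case: (eqVneq #|A'| i.+1) => [cA|/h2 ->]; last exact: mem0v.
have [AL [BL [oL eL sL]]] := up_set_split L A'.
have [AR [BR [oR eR sR]]] := up_set_split R A'.
(* [BL] and [BR] have at most [i.+1] elements, so both reduced bounds are still at least [d.-1]. *)
have cL := subset_leq_card sL; have cR := subset_leq_card sR; rewrite cA in cL cR.
have d2 : (0 < d.-2)%N by lia.
apply: (@join_Jdeg b (b - #|BL|) (b - #|BR|)); rewrite ?leq_subr //; try by rewrite /b; lia.
- have [_ _ _ /(_ AL)] := hVL _ oL.
  rewrite -(@restrict_chain_fix K n1 n2 _ L R lshift_mono _ b i.+2 d.-2 BL w VL VR (disj_imageb L) (disj_imageb R)) //.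
  + rewrite slice_restrict_chain -eL -/U => J.
    by rewrite -[restrict_poly _ _ _]scale1r -(up_signK L BL AL 1) mulr1 -scalerA rpredZ.
  + exact: leq_subr.
  + exact: outside_lr.
  + by move=> B /disj_imageP.
  + exact/disj_imageP.
  + by move=> B /disj_imageP/hVL [].
  + by move=> B /disj_imageP/hVR [q1 _ q3 _]; split=> //; apply: Zsp_homog q1.
- have [_ _ _ /(_ AR)] := hVR _ oR.
  rewrite -(@restrict_chain_fix K n2 n1 _ R L rshift_mono _ b i.+2 d.-2 BR w VR VL (disj_imageb R) (disj_imageb L)) //.
  + rewrite slice_restrict_chain -eR (addrC (\sum_(B | disj_imageb R B) _)) -/U => J.
    by rewrite -[restrict_poly _ _ _]scale1r -(up_signK R BR AR 1) mulr1 -scalerA rpredZ.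
  + exact: leq_subr.
  + by move=> k; rewrite orbC outside_lr.
  + by move=> B /disj_imageP.
  + exact/disj_imageP.
  + by move=> B /disj_imageP/hVR [].
  + by move=> B /disj_imageP/hVL [q1 _ q3 _]; split=> //; apply: Zsp_homog q1.
Qed.

End Join.

(** * Induced paths on three vertices *)

Section Path.
Local Open Scope ring_scope.
Variables (K : fieldType) (n : nat) (g : rel 'I_n).
Hypothesis gs : symmetric g.
Notation V := ('I_n * bool)%type.

Definition exp2 (k l : V) (x : V) : nat := ((x == k) + (x == l))%N.
Definition exp3 (k l m : V) (x : V) : nat := ((x == k) + (x == l) + (x == m))%N.

Lemma deg_exp2 k l : deg (exp2 k l) = 2. Proof. by rewrite /deg big_split /= !sum_pred1. Qed.
Lemma deg_exp3 k l m : deg (exp3 k l m) = 3.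
Proof. by rewrite /deg !big_split /= !sum_pred1. Qed.

Lemma exp2_eq (a c k l : V) : [forall x, exp2 k l x == exp2 a c x] =
  ((a == k) && (c == l)) || ((a == l) && (c == k)).
Proof.
apply/forallP/orP => [h|[/andP[/eqP -> /eqP ->] //|/andP[/eqP -> /eqP ->] x]]; last first.
  by rewrite /exp2 addnC.
have ha := eqP (h a); have hk := eqP (h k); have hl := eqP (h l).
have [e|ak] := eqVneq a k.
  left; move: hl; rewrite e /exp2 eqxx => /addnI; rewrite eq_sym => /esym.
  by case: (c == l).
right; move: ha hk; rewrite /exp2 (negbTE ak) eqxx; case: eqVneq => [-> _|//].
by rewrite eqxx addnC => /addnI; rewrite eq_sym; case: (c == k).
Qed.

Lemma monom_exp2 e a c k l : deg e = 0%N ->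
  monom K 4 (exp_add2 e a c) (mon_of 4 (exp2 k l)) = (((a == k) && (c == l)) || ((a == l) && (c == k)))%:R.
Proof.
move=> e0; rewrite monomE -exp2_eq; congr (_%:R); congr (nat_of_bool _).
apply: eq_forallb => x; rewrite mon_ofE ?deg_exp2 // /exp_add2.
by have := deg_le e x; rewrite e0 leqn0 => /eqP ->; rewrite add0n.
Qed.

Lemma gen_mul_comb_at a e i j (y : poly_space K V 4) q : (a *: gen_mul K 4 e (edge_gen i j) + y) q =
  a * (monom K 4 (exp_add2 e (i, false) (j, true)) q - monom K 4 (exp_add2 e (j, false) (i, true)) q) + y q.
Proof. by rewrite !ffunE. Qed.

Lemma gen_mul_at e (i j : 'I_n) q : gen_mul K 4 e (edge_gen i j) q =
  monom K 4 (exp_add2 e (i, false) (j, true)) q - monom K 4 (exp_add2 e (j, false) (i, true)) q.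
Proof. by rewrite !ffunE. Qed.

Section Degree2.
Variable p : poly_space K V 4.
Hypothesis pJ : p \in Jdeg K 4 (bei_gens g) 2.

(** With the next two lemmas, the linear conditions on quadrics of the ideal by which a bounding
    chain is followed in [path_not_exact]. *)
Lemma J2_same i j t : p (mon_of 4 (exp2 (i, t) (j, t))) = 0.
Proof.
move: p pJ; apply: Jdeg_ind => [|a e x y /bei_gensP [i' [j' [_ _ ->]]] ed IH].
  by rewrite ffunE.
have e0 : deg e = 0%N by lia.
rewrite gen_mul_comb_at IH addr0 !monom_exp2 //= !xpair_eqE.
by case: t {IH} => /=; rewrite !andbF /= ?subrr ?mulr0.
Qed.

Lemma J2_nonedge i j : ~~ g i j -> p (mon_of 4 (exp2 (i, false) (j, true))) = 0.
Proof.
move=> gij; move: p pJ; apply: Jdeg_ind => [|a e x y /bei_gensP [i' [j' [gij' _ ->]]] ed IH].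
  by rewrite ffunE.
have e0 : deg e = 0%N by lia.
rewrite gen_mul_comb_at IH addr0 !monom_exp2 //= !xpair_eqE /= !andbF !andbT !orbF /=.
case: andP => [[/eqP E1 /eqP E2]|_]; first by rewrite -E1 -E2 gij' in gij.
case: andP => [[/eqP E1 /eqP E2]|_]; first by rewrite -E1 -E2 gs gij' in gij.
by rewrite subrr mulr0.
Qed.

Lemma J2_swap i j :
  p (mon_of 4 (exp2 (i, false) (j, true))) + p (mon_of 4 (exp2 (j, false) (i, true))) = 0.
Proof.
move: p pJ; apply: Jdeg_ind => [|a e x y /bei_gensP [i' [j' [gij' _ ->]]] ed IH].
  by rewrite !ffunE addr0.
have e0 : deg e = 0%N by lia.
rewrite !gen_mul_comb_at addrACA IH addr0 !monom_exp2 // -mulrDr !xpair_eqE /= !andbF !andbT !orbF /=.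
by rewrite [(j' == i) && _]andbC [(j' == j) && _]andbC addrA subrK subrr mulr0.
Qed.

End Degree2.

Lemma mshift_exp3 k l m : mshift (mon_of 4 (exp3 k l m)) k = mon_of 4 (exp2 l m).
Proof.
apply/ffunP => x; apply: val_inj; rewrite /= mshiftE !mon_ofE ?deg_exp3 ?deg_exp2 //.
by rewrite /exp3 /exp2 -addnA addKn.
Qed.

Lemma eq_mon_of (b : nat) (e e' : V -> nat) : e =1 e' -> mon_of b e = mon_of b e'.
Proof. by move=> E; apply/ffunP => x; rewrite !ffunE E. Qed.

Lemma exp3C k l m : exp3 k l m =1 exp3 l k m.
Proof. by move=> x; rewrite /exp3 [((x == k) + _)%N]addnC. Qed.

Lemma exp3R k l m : exp3 k l m =1 exp3 m k l.
Proof. by move=> x; rewrite /exp3 addnC addnA. Qed.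

Lemma kdiff_one b (psi : kspace K V b) (A : {set V}) (u : mon V b) k : k \notin A -> (0 < u k)%N ->
  (forall l, l != k -> (0 < u l)%N -> psi (l |: A, mshift u l) = 0) ->
  kdiff K V b psi (A, u) = ksign K k A * psi (k |: A, mshift u k).
Proof.
move=> kA uk h; rewrite kdiffE (bigD1 k) /= ?kA ?uk // big1 ?addr0 // => l.
by move=> /andP[/andP[_ ul] lk]; rewrite h // mulr0.
Qed.

Lemma tens_Zsp b gens i d (A : {set V}) f : #|A| = i -> f \in Jdeg K b gens d ->
  tens A f \in Zsp K b gens i d.
Proof.
move=> Ai fJ; apply/Zsp_P => B; rewrite slice_tens; case: eqP => [->|_].
  by rewrite fJ Ai eqxx.
by rewrite mem0v.
Qed.

Definition exp1 (k x : V) : nat := (x == k).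

Lemma deg_exp1 k : deg (exp1 k) = 1%N. Proof. exact: sum_pred1. Qed.

Variables (u v w : 'I_n).
Hypotheses (guw : g u w) (gvw : g v w) (guv : ~~ g v u).
Hypotheses (uw : u != w) (vw : v != w) (uv : u != v).

(* The Koszul syzygy between the generators of the edges [uw] and [vw]. *)
Definition path_syzygy : kspace K V 4 :=
  tens [set (v, false)] (gen_mul K 4 (exp1 (w, true)) (edge_gen u w))
  - tens [set (u, false)] (gen_mul K 4 (exp1 (w, true)) (edge_gen v w))
  + tens [set (w, false)] (gen_mul K 4 (exp1 (u, true)) (edge_gen v w) - gen_mul K 4 (exp1 (v, true)) (edge_gen u w)).

Lemma path_syzygy_Zsp : path_syzygy \in Zsp K 4 (bei_gens g) 1 3.
Proof.
have J k i j : g i j -> i != j -> gen_mul K 4 (exp1 k) (edge_gen i j) \in Jdeg K 4 (bei_gens g) 3.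
  by move=> gij ij; apply: swapJ; rewrite ?deg_exp1.
apply: rpredD; first by apply: rpredB; apply: tens_Zsp; rewrite ?cards1 ?J.
by apply: tens_Zsp; [rewrite cards1 | apply: rpredB; apply: J].
Qed.

Lemma slice_path_syzygy (k : V) : slice [set k] path_syzygy =
  (if k == (v, false) then gen_mul K 4 (exp1 (w, true)) (edge_gen u w) else 0)
  - (if k == (u, false) then gen_mul K 4 (exp1 (w, true)) (edge_gen v w) else 0)
  + (if k == (w, false) then gen_mul K 4 (exp1 (u, true)) (edge_gen v w) - gen_mul K 4 (exp1 (v, true)) (edge_gen u w)
     else 0).
Proof.
rewrite /path_syzygy !sliceD -scaleN1r sliceZ scaleN1r !slice_tens.
by rewrite !(inj_eq set1_inj).
Qed.

(** Multiplying out gives [f_vw f_uw - f_uw f_vw], where the [x] variable in each monomial of the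
    first factor has been moved to the exterior part. *)
Lemma path_syzygy_cycle : kdiff K V 4 path_syzygy = 0.
Proof.
apply/ffunP => -[A m]; rewrite [RHS]ffunE.
have := slice_kdiff A path_syzygy; have [-> E|A0 E] := eqVneq A set0; last first.
  have /ffunP/(_ m) : slice A (kdiff K V 4 path_syzygy) = 0.
    have /Zsp_P/(_ A) [_] := @kdiff_Zsp K _ 4 (bei_gens g) 0 3 _ isT path_syzygy_Zsp.
    by apply; rewrite cards_eq0.
  by rewrite !ffunE.
have {}E : slice set0 (kdiff K V 4 path_syzygy) = \sum_k mulx k (slice [set k] path_syzygy).
  rewrite E; apply: eq_big => [k|k _]; first by rewrite inE.
  rewrite setU0 /ksign (_ : [set a in set0 | _] = set0) ?cards0 ?scale1r //.
  by apply/setP => x; rewrite !inE.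
suff S0 : slice set0 (kdiff K V 4 path_syzygy) = 0 by move/ffunP/(_ m): S0; rewrite !ffunE.
have m0 k : mulx k 0 = 0 :> poly_space K V 4.
  by apply/ffunP => x; rewrite !ffunE if_same.
have mB k (p q : poly_space K V 4) : mulx k (p - q) = mulx k p - mulx k q.
  by rewrite -scaleN1r mulxD mulxZ scaleN1r.
have one k0 (q : poly_space K V 4) : \sum_k mulx k (if k == k0 then q else 0) = mulx k0 q.
  by rewrite (bigD1 k0) //= eqxx big1 ?addr0 // => k /negbTE ->.
rewrite {}E; under eq_bigr => k _ do rewrite slice_path_syzygy mulxD mB.
have D k a c d : mulx k (monom K 4 (exp_add2 (exp1 a) c d)) =
    monom K 4 (fun x => (x == a) + (x == c) + (x == d) + (x == k))%N by rewrite mulx_monom.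
have Q a c d k a' c' d' k' : (fun x : V => (x == a) + (x == c) + (x == d) + (x == k))%N
    =1 (fun x => (x == a') + (x == c') + (x == d') + (x == k'))%N ->
    mulx k (monom K 4 (exp_add2 (exp1 a) c d)) = mulx k' (monom K 4 (exp_add2 (exp1 a') c' d')).
  by move=> e; rewrite !D; apply: eq_monom.
rewrite big_split sumrB /= !one /gen_mul /edge_gen /= !mB.
(* The eight monomials cancel in four pairs. *)
rewrite (Q (w, true) (u, false) (w, true) (v, false) (w, true) (v, false) (w, true) (u, false));
  last by move=> x; ring.
rewrite (Q (w, true) (w, false) (u, true) (v, false) (u, true) (v, false) (w, true) (w, false));
  last by move=> x; ring.
rewrite (Q (w, true) (w, false) (v, true) (u, false) (v, true) (u, false) (w, true) (w, false));
  last by move=> x; ring.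
rewrite (Q (u, true) (w, false) (v, true) (w, false) (v, true) (w, false) (u, true) (w, false));
  last by move=> x; ring.
move: (mulx _ _) (mulx _ _) (mulx _ _) (mulx _ _) => p1 p2 p3 p4.
by rewrite !opprB [p4 - p3 + _]addrC !addrA !subrK subrr.
Qed.

(* Following coefficients of a bound [psi] of the syzygy: the coefficient of [psi] at
   [e_(y_w) e_(x_v)] is a multiple of the generator of [uw], nonzero by one equation and zero by
   another. *)
Lemma path_not_exact : ~ exactK K (bei_gens g) 1 3.
Proof.
move=> ex; have [psi psiZ psiD] := ex _ path_syzygy_Zsp path_syzygy_cycle; rewrite /= in psiZ.
rewrite -/(1 + 3)%N in psi psiZ psiD *.
have /Zsp_P pZ := psiZ; have pJ A := (pZ A).1.
have uw2 t t' : (u, t) == (w, t') = false by rewrite xpair_eqE (negbTE uw).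
have vw2 t t' : (v, t) == (w, t') = false by rewrite xpair_eqE (negbTE vw).
have uv2 t t' : (u, t) == (v, t') = false by rewrite xpair_eqE (negbTE uv).
have mkpos k l m o : (0 < mon_of 4 (exp3 k l m) o)%N -> [|| o == k, o == l | o == m].
  by rewrite mon_ofE ?deg_exp3 // /exp3; do 3![case: (o == _)].
pose e1 := ([set (v, false)] : {set V}); pose e2 := ([set (w, true)] : {set V}).
(* Compare coefficients at the set [{x_v}] and the monomial [x_u y_w^2], where the syzygy is 1.
   Dividing by [x_u] leaves [y_w^2], which no quadric of the ideal contains, so only the division by
   [y_w] contributes. *)
have E1 : psi ((w, true) |: e1, mon_of 4 (exp2 (u, false) (w, true))) != 0.
  have tE : mon_of 4 (exp3 (u, false) (w, true) (w, true)) = mon_of 4 (exp3 (w, true) (u, false) (w, true)).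
    exact/eq_mon_of/exp3C.
  have := kdiff_one (psi := psi) (A := e1) (u := mon_of 4 (exp3 (w, true) (u, false) (w, true)))
     (k := (w, true)).
  rewrite psiD mshift_exp3 => /(_ _ _ _) H.
  have {}H : path_syzygy (e1, mon_of 4 (exp3 (w, true) (u, false) (w, true))) =
     ksign K (w, true) e1 * psi ((w, true) |: e1, mon_of 4 (exp2 (u, false) (w, true))).
    apply: H.
    - by rewrite inE eq_sym vw2.
    - by rewrite mon_ofE ?deg_exp3 // /exp3 eqxx.
    - move=> l lw /mkpos; rewrite (negbTE lw) orbF /= => /eqP ->.
      rewrite -tE mshift_exp3; have := J2_same (pJ ((u, false) |: e1)) w w true.
      by rewrite ffunE.
  move: H; have -> : path_syzygy (e1, mon_of 4 (exp3 (w, true) (u, false) (w, true))) = 1.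
    have /ffunP/(_ (mon_of 4 (exp3 (w, true) (u, false) (w, true)))) := slice_path_syzygy (v, false).
    rewrite ffunE => ->; rewrite eqxx [(v, _) == (u, _)]eq_sym uv2 vw2 subr0 addr0.
    rewrite gen_mul_at !monomE.
    rewrite (introT forallP); last first.
      by move=> x; rewrite mon_ofE ?deg_exp3 // /exp3 /exp_add2 /exp1 addnC addnA addnC; apply/eqP;
        ring.
    case: forallP => [/(_ (w, false))|]; last by rewrite subr0.
    rewrite mon_ofE ?deg_exp3 // /exp3 /exp_add2 /exp1 !xpair_eqE /= !andbF.
    by rewrite [w == u]eq_sym (negbTE uw) !eqxx /=.
  by move=> e; apply/eqP => z; move/eqP: e; rewrite z mulr0 oner_eq0.
(* At the set [{y_w}] and the monomial [x_v x_w y_u] the syzygy is 0. Dividing by [x_w] leaves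
   [x_v y_u], excluded because [uv] is not an edge, and dividing by [y_u] leaves [x_v x_w], excluded
   as a product of two [x] variables. *)
have E2 : psi ((v, false) |: e2, mon_of 4 (exp2 (w, false) (u, true))) = 0.
  have := kdiff_one (psi := psi) (A := e2) (u := mon_of 4 (exp3 (v, false) (w, false) (u, true)))
     (k := (v, false)).
  rewrite psiD mshift_exp3 => H.
  have {}H : path_syzygy (e2, mon_of 4 (exp3 (v, false) (w, false) (u, true))) =
     ksign K (v, false) e2 * psi ((v, false) |: e2, mon_of 4 (exp2 (w, false) (u, true))).
    apply: H.
    - by rewrite inE vw2.
    - by rewrite mon_ofE ?deg_exp3 // /exp3 eqxx.
    - move=> l lv /mkpos; rewrite (negbTE lv) /= => /orP[] /eqP ->.
        rewrite (eq_mon_of 4 (exp3C _ _ _)) mshift_exp3.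
        by have := J2_nonedge (pJ ((w, false) |: e2)) guv; rewrite ffunE.
      rewrite (eq_mon_of 4 (exp3R _ _ _)) mshift_exp3.
      by have := J2_same (pJ ((u, true) |: e2)) v w false; rewrite ffunE.
  move: H; have -> : path_syzygy (e2, mon_of 4 (exp3 (v, false) (w, false) (u, true))) = 0.
    have /ffunP/(_ (mon_of 4 (exp3 (v, false) (w, false) (u, true)))) := slice_path_syzygy (w, true).
    rewrite ffunE => ->; rewrite !xpair_eqE !andbF subr0 addr0 ffunE //.
  by move/esym/eqP; rewrite mulf_eq0 signr_eq0 /= => /eqP.
(* [x_u y_w] and [x_w y_u] have opposite coefficients in a quadric of the ideal, which contradicts
   [E1] and [E2]. *)
have := J2_swap (pJ ((v, false) |: e2)) u w; rewrite !ffunE E2 addr0.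
by apply/eqP; rewrite /e2 setUC.
Qed.

End Path.

(** * Regularity of the join *)

Theorem theorem4p2 (K : fieldType) (n1 n2 : nat) (e1 : rel 'I_n1) (e2 : rel 'I_n2) :
  (0 < n1)%N -> (0 < n2)%N ->
  simple_graph e1 -> simple_graph e2 ->
  ~ (complete_graph e1 /\ complete_graph e2) ->
  forall r1 r2 : nat,
    is_reg K (bei_gens e1) r1 -> is_reg K (bei_gens e2) r2 ->
    is_reg K (bei_gens (join_graph e1 e2)) (maxn (maxn r1 r2) 3).
Proof.
move=> n1_gt0 n2_gt0 [s1 i1] [s2 i2] ncomp r1 r2 [reg1 ex1] [reg2 ex2].
have sG := join_sym s1 s2.
(* The ends of the path are two non-adjacent vertices of one factor, and its middle vertex is any
   vertex of the other factor, which must therefore be non-empty. *)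
have b13 : betti K (bei_gens (join_graph e1 e2)) 1 4 <> 0.
  move=> /(betti_exact K (bei_gens (join_graph e1 e2)) 1 3).
  have [/forallP c1|] := boolP [forall u, forall v, (u != v) ==> e1 u v].
    have [/forallP c2|] := boolP [forall u, forall v, (u != v) ==> e2 u v].
      by case: ncomp; split=> u v uv;
        [move/forallP/(_ v)/implyP: (c1 u) | move/forallP/(_ v)/implyP: (c2 u)]; apply.
    move=> /forallPn [u /forallPn [v]]; rewrite negb_imply => /andP[uv e].
    apply: (@path_not_exact _ _ _ sG (rshift n1 u) (rshift n1 v) (lshift n2 (Ordinal n1_gt0)));
      by rewrite ?join_rl ?join_rr ?eq_rlshift ?eq_rshift // s2.
  move=> /forallPn [u /forallPn [v]]; rewrite negb_imply => /andP[uv e].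
  apply: (@path_not_exact _ _ _ sG (lshift n2 u) (lshift n2 v) (rshift n1 (Ordinal n2_gt0)));
    by rewrite ?join_lr ?join_ll ?eq_lrshift ?eq_lshift // s1.
have sub1 i d : betti K (bei_gens e1) i (i + d) <> 0 ->
    betti K (bei_gens (join_graph e1 e2)) i (i + d) <> 0.
  move=> nz /betti_exact h; apply: nz; apply/betti_exact.
  exact: (induced_exact (@lshift_mono n1 n2) (join_ll e1 e2) h).
have sub2 i d : betti K (bei_gens e2) i (i + d) <> 0 ->
    betti K (bei_gens (join_graph e1 e2)) i (i + d) <> 0.
  move=> nz /betti_exact h; apply: nz; apply/betti_exact.
  exact: (induced_exact (@rshift_mono n1 n2) (join_rr e1 e2) h).
split=> [i j nz|].
  (* [betti] is 0 by definition for [j < i], so the difference [j - i] below is not truncated. *)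
  have ij : i <= j by move: nz; rewrite /betti; case: leqP.
  rewrite leqNgt; apply/negP => lt; apply: nz; rewrite -(subnKC ij).
  have ex (m : nat) (e : rel 'I_m) r : (forall i' j', betti K (bei_gens e) i' j' <> 0 ->
    j' <= i' + r) ->
      r < j - i -> forall i', exactK K (bei_gens e) i' (j - i).
    move=> reg rl i'; apply/betti_exact; apply/eqP; case: eqP => // /reg.
    by rewrite leq_add2l leqNgt rl.
  apply/betti_exact; apply: join_exact => //.
  - by move: lt; lia.
  - by apply: ex reg1 _; lia.
  - by apply: ex reg2 _; lia.
(* A maximum of 3 is attained at [(1, 4)]. Otherwise the larger of [r1] and [r2] exceeds 3, so it is
   attained by a non-zero Betti number and is not the convention for the zero ideal. *)
left; case: (leqP (maxn r1 r2) 3) => h; first by exists 1, 4.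
have [h12|h12] := leqP r1 r2.
  case: ex2 => [[i [j [nz e]]]|[r0 _]]; last by move: h; lia.
  by exists i, j; split=> //; rewrite e; apply: sub2; rewrite -e.
case: ex1 => [[i [j [nz e]]]|[r0 _]]; last by move: h; lia.
by exists i, j; split=> //; rewrite e; apply: sub1; rewrite -e.
Qed.
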